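(* Let $\Delta>0$ be the discriminant of a real quadratic field and $D=|\Delta|=\Delta$. The generalized Paley graph $P_\Delta$ is a Ramanujan graph if and only if one of the following holds: (1) $D=8$; (2) $D=4p$, where $p$ is a prime number with $p\equiv 3\pmod 4$; (3) $D=8p$, where $p$ is an odd prime number; (4) $D=4p_1p_2$, where $p_1$ and $p_2$ are primes, $p_1p_2\equiv 3\pmod 4$ and $p_1<p_2\leq 4p_1-5$; (5) $D=8p_1p_2$, where $p_1$ and $p_2$ are primes and $2<p_1<p_2\leq 2p_1-3$; (6) $D$ is a prime number $p$ with $p\equiv 1\pmod 4$; (7) $D=p_1p_2$, where $p_1$ and $p_2$ are primes, $p_1p_2\equiv 1\pmod 4$ and $p_1<p_2\leq 8p_1-9$.
   Context: Let $m\neq 1$ be a squarefree integer and let $\Delta$ be the discriminant of the quadratic field $\mathbb{Q}(\sqrt{m})$: $\Delta=m$ if $m\equiv 1\pmod 4$, and $\Delta=4m$ if $m\equiv 2,3\pmod 4$. Put $D=|\Delta|$. The function $\chi_\Delta(a)=\left(\frac{\Delta}{a}\right)$ (Kronecker symbol, $a\in\mathbb{Z}$) is the associated primitive quadratic Dirichlet character of conductor $D$; it is periodic mod $D$ and vanishes when $\gcd(a,D)>1$. The generalized Paley graph $P_\Delta$ has vertex set $\{0,1,\dots,D-1\}$, with $u$ and $v$ connected if and only if $\chi_\Delta(v-u)=1$. It is undirected when $\Delta>0$. Ramanujan graph: let $G$ be a connected $r$-regular (undirected) graph with $N$ vertices and let $r=\lambda_1\geq\lambda_2\geq\cdots\geq\lambda_N$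 be the eigenvalues of its adjacency matrix (so $|\lambda_i|\le r$). Put $\lambda(G)=\max_{|\lambda_i|<r}|\lambda_i|$. The graph $G$ is a Ramanujan graph if $\lambda(G)\leq 2\sqrt{r-1}$. *)

(* Defs.v *)
From mathcomp Require Import all_boot all_order all_algebra.
From mathcomp Require Import polyrcf.

Set Implicit Arguments.
Unset Strict Implicit.
Unset Printing Implicit Defensive.

Import Order.TTheory GRing.Theory Num.Theory.

Local Open Scope ring_scope.

Definition squarefree (m : int) : Prop :=
  forall d : nat, (d ^ 2 %| `|m|)%N -> d = 1%N.

(* Discriminant of Q(sqrt m), for squarefree m <> 1. *)
Definition quad_disc (m : int) : int :=
  if (m == 1 %[mod 4])%Z then m else 4 * m.

(* Legendre symbol; meaningful for p an odd prime. *)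
Definition legendre (a : int) (p : nat) : int :=
  if (p%:Z %| a)%Z then 0
  else if [exists x : 'I_p, ((x%:Z ^+ 2) == a %[mod p%:Z])%Z] then 1 else -1.

(* The Kronecker symbol (a / p) at a prime p. *)
Definition kronecker_prime (a : int) (p : nat) : int :=
  if p == 2%N then
    if (2 %| a)%Z then 0
    else if ((a == 1 %[mod 8])%Z || (a == -1 %[mod 8])%Z) then 1 else -1
  else legendre a p.

(* The Kronecker symbol (a / b): completely multiplicative in b <> 0, with
   (a / -1) the sign of a (and 1 if a = 0), and (a / 0) = 1 iff a = 1 or -1. *)
Definition kronecker (a b : int) : int :=
  if b == 0 then (if `|a|%N == 1%N then 1 else 0)
  else (if (a < 0) && (b < 0) then -1 else 1)
       * \prod_(f <- prime_decomp `|b|%N) kronecker_prime a f.1 ^+ f.2.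

(* The difference v - u is taken in Z, not in 'I_D. *)
Definition paley (Delta : int) : rel 'I_(`|Delta|%N) :=
  fun u v => kronecker Delta ((v : nat)%:Z - (u : nat)%:Z) == 1.

Section Graphs.
Variables (T : finType) (e : rel T).

Definition undirected : Prop := symmetric e /\ irreflexive e.

Definition connected_graph : Prop := forall u v : T, connect e u v.

Definition regular (r : nat) : Prop := forall u : T, #|[set v | e u v]| = r.

Variable R : rcfType.

Definition adjacency : 'M[R]_#|T| :=
  \matrix_(i, j) (e (enum_val i) (enum_val j))%:R.

(* The eigenvalues, listed without repetition, are the roots in R of the
   characteristic polynomial. *)
Definition eigenvalues : seq R := rootsR (char_poly adjacency).

(* lambda(G) for G of degree r; all values are nonnegative, so the default
   value 0 does not affect a nonempty maximum. *)
Definition lambda (r : nat) : R :=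
  \big[Num.max/0]_(a <- eigenvalues | `|a| < r%:R) `|a|.

Definition ramanujan : Prop :=
  exists r : nat, [/\ undirected, connected_graph, regular r
    & lambda r <= 2 * Num.sqrt (r%:R - 1)].

End Graphs.

(* Main.v *)
Require Import Defs.
From mathcomp Require Import all_boot all_order all_algebra.
From mathcomp Require Import all_field cyclic polyrcf complex ring lra zify.
Import Order.TTheory GRing.Theory Num.Theory.
Local Open Scope ring_scope.
Set Implicit Arguments.
Unset Strict Implicit.
Unset Printing Implicit Defensive.

(** The graph is a circulant, so its eigenvalues are
    [(c(k) + chi(k) tau) / 2] for [0 <= k < D], where [c(k)] is the Ramanujan sum
    of [D] and [tau] the Gauss sum of [chi], with [tau ^ 2 = D].  The degree is
    [phi(D) / 2].  If [p] is the least odd prime factor of [D] and [p < D], the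
    largest nontrivial eigenvalue comes from [k = D / p] and has absolute value
    [phi(D) / (2 (p - 1))].  Comparing it with [2 sqrt(phi(D) / 2 - 1)] rules out
    three odd prime factors and, for two of them, gives the stated bounds; the
    values with [k] coprime to [D] never matter.

    That the Kronecker symbol is periodic modulo [D] is quadratic reciprocity.  A
    primitive quadratic character [chi] of conductor [D] is built from Legendre
    symbols and characters modulo 8, and the action of Frobenius on its Gauss sum
    in characteristic [q] shows that [chi q] is the Legendre symbol of
    [chi (- 1) * D] modulo [q]. *)

(** * Sums over residues and Gauss sums *)

Definition zperiodic (V : Type) (D : nat) (F : int -> V) : Prop :=
  forall a b : int, (D%:Z %| a - b)%Z -> F a = F b.

(** Reduced modulo [D], the map [h] is an injection of the finite set of residues into itself, hence
    a permutation, and [F] sees residues only. *)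
Lemma sum_residues_reindex (V : nmodType) (D : nat) (F : int -> V)
    (h : int -> int) :
    zperiodic D F ->
    (forall a b : int, (D%:Z %| h a - h b)%Z -> (D%:Z %| a - b)%Z) ->
  \sum_(a < D) F (h a%:Z) = \sum_(a < D) F a%:Z.
Proof.
move=> perF injh.
have D_gt0 (a : 'I_D) : (0 < D)%N by apply: leq_trans (ltn_ord a).
have lt_mod (a : 'I_D) : (`|(h a%:Z %% D%:Z)%Z| < D)%N.
  have := D_gt0 a; have := modz_ge0 (h a%:Z) (d := D%:Z).
  have := ltz_mod (h a%:Z) (d := D%:Z); lia.
have valE (a : 'I_D) : `|(h a%:Z %% D%:Z)%Z|%:Z = (h a%:Z %% D%:Z)%Z.
  by rewrite gez0_abs // modz_ge0 //; have := D_gt0 a; lia.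
pose r a := Ordinal (lt_mod a).
have r_inj : injective r.
  move=> a b /(congr1 (fun i : 'I_D => (i : nat)%:Z)) /= /eqP.
  rewrite !valE eqz_mod_dvd => /injh.
  by rewrite -eqz_mod_dvd !modz_small ?ltz_nat ?ltn_ord // => /eqP[] /val_inj.
rewrite [RHS](reindex_inj r_inj); apply: eq_bigr => a _; apply: perF.
by rewrite /= valE -eqz_mod_dvd modz_mod.
Qed.

Lemma sum_residues_shift (V : nmodType) (D : nat) (F : int -> V) (t : int) :
    zperiodic D F ->
  \sum_(a < D) F (a%:Z + t) = \sum_(a < D) F a%:Z.
Proof.
move=> perF; apply: (sum_residues_reindex (h := fun a => a + t)) => // a b.
by congr (_ %| _)%Z; ring.
Qed.

Lemma sum_residues_scale (V : nmodType) (D : nat) (F : int -> V) (c : int) :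
    zperiodic D F -> coprimez c D ->
  \sum_(a < D) F (c * a%:Z) = \sum_(a < D) F a%:Z.
Proof.
move=> perF cop_cD; apply: (sum_residues_reindex (h := *%R c)) => // a b.
by rewrite -mulrBr Gauss_dvdzr // coprimez_sym.
Qed.

Lemma coprimez_congr (D : nat) : zperiodic D (coprimez^~ D%:Z).
Proof.
move=> a b; rewrite -eqz_mod_dvd => /eqP eq_ab.
by rewrite /coprimez -gcdz_modl eq_ab gcdz_modl.
Qed.

Section PrimitiveRoot.
Variables (K : fieldType) (D : nat) (z : K).
Hypothesis prim_z : D.-primitive_root z.

Lemma prim_root_neq0 : z != 0.
Proof. by rewrite (prim_root_eq0 prim_z) -lt0n (prim_order_gt0 prim_z). Qed.

Lemma prim_exprz_eq1 (k : int) : (z ^ k == 1) = (D%:Z %| k)%Z.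
Proof.
case: k => k; first by rewrite /exprz -(prim_order_dvd prim_z) dvdzE.
by rewrite /exprz invr_eq1 -(prim_order_dvd prim_z) dvdzE.
Qed.

Lemma prim_exprz_congr (k : int) : zperiodic D (fun a => z ^ (k * a)).
Proof.
move=> a b dvd_ab; have -> : k * a = k * (a - b) + k * b by ring.
rewrite expfzDr ?prim_root_neq0 //.
have /eqP-> : z ^ (k * (a - b)) == 1 by rewrite prim_exprz_eq1 dvdz_mull.
by rewrite mul1r.
Qed.

Lemma prim_exprz_periodic : zperiodic D (exprz z).
Proof. by move=> a b /(prim_exprz_congr 1); rewrite !mul1r. Qed.

Lemma sum_prim_exprz (k : int) :
  \sum_(a < D) z ^ (k * a%:Z) = if (D%:Z %| k)%Z then D%:R else 0.
Proof.
case: ifP => [dvd_k|ndvd_k].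
  rewrite (eq_bigr (fun=> 1)) ?sumr_const ?card_ord // => a _.
  by apply/eqP; rewrite prim_exprz_eq1 dvdz_mulr.
have /negP nz1 : z ^ k != 1 by rewrite prim_exprz_eq1 ndvd_k.
(* Shifting the index by 1 multiplies the sum by [z ^ k], which is not 1, so the sum vanishes. *)
set S := \sum_(a < D) _; have eqS : S = z ^ k * S.
  rewrite {1}/S -(sum_residues_shift 1 (prim_exprz_congr k)) mulr_sumr.
  apply: eq_bigr => a _; rewrite -expfzDr ?prim_root_neq0 //.
  by congr (z ^ _); ring.
have /eqP : (z ^ k - 1) * S = 0 by rewrite mulrBl -eqS mul1r subrr.
by rewrite mulf_eq0 subr_eq0 => /orP[/nz1|/eqP].
Qed.

End PrimitiveRoot.

(* The last clause is primitivity: [chi] is not induced from any [D / p]. *)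
Definition quadratic_character (D : nat) (chi : int -> int) : Prop :=
  [/\ zperiodic D chi,
      forall a b, chi (a * b) = chi a * chi b,
      forall a, chi a ^+ 2 = (coprimez a D)%:R
    & forall p : nat, prime p -> (p %| D)%N ->
      exists2 c : int, ((D %/ p)%:Z %| c - 1)%Z & chi c = -1].

Section CharacterValues.
Variables (D : nat) (chi : int -> int).
Hypothesis chi_char : quadratic_character D chi.

Lemma char_eq0 (a : int) : (chi a == 0) = ~~ coprimez a D.
Proof.
case: chi_char => _ _ sq _; have := expf_eq0 (chi a) 2.
by rewrite sq /= => <-; case: coprimez.
Qed.

Lemma char_val (a : int) : coprimez a D -> chi a = 1 \/ chi a = -1.
Proof.
case: chi_char => _ _ sq _ cop_a; move/eqP: (sq a).
by rewrite cop_a sqrf_eq1 => /orP[/eqP|/eqP]; [left | right].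
Qed.

Lemma char_range (a : int) : [\/ chi a = 0, chi a = 1 | chi a = -1].
Proof.
have [/char_val[]|ncop_a] := boolP (coprimez a D).
- by constructor 2.
- by constructor 3.
- by constructor 1; apply/eqP; rewrite char_eq0.
Qed.

Lemma char_coprime (a : int) : chi a != 0 -> coprimez a D.
Proof. by rewrite char_eq0 negbK. Qed.

Lemma char1 : chi 1 = 1.
Proof.
case: chi_char => _ mul _ _; have := mul 1 1; rewrite mulr1.
have : chi 1 != 0 by rewrite char_eq0 negbK coprimezE coprime1n.
by move=> nz /esym/eqP; rewrite -subr_eq0 -{3}[chi 1]mulr1 -mulrBr mulf_eq0
  (negPf nz) subr_eq0 => /eqP.
Qed.

Section Gauss.
Variables (K : fieldType) (z : K).
Hypotheses (prim_z : D.-primitive_root z) (two_neq0 : 2%:R != 0 :> K).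

Definition gauss_sum : K := \sum_(a < D) (chi a%:Z)%:~R * z ^ a%:Z.

Lemma zperiodic_gauss (k : int) :
  zperiodic D (fun a => (chi a)%:~R * z ^ (k * a)).
Proof.
case: chi_char => per _ _ _ a b dvd_ab.
by rewrite (per _ _ dvd_ab) (prim_exprz_congr prim_z k dvd_ab).
Qed.

(* When [k] is not coprime to [D], primitivity provides [c] with
   [k c = k mod D] and [chi c = -1], so that the sum is its own opposite. *)
Lemma gauss_sum_twist (k : int) :
  \sum_(a < D) (chi a%:Z)%:~R * z ^ (k * a%:Z) = (chi k)%:~R * gauss_sum.
Proof.
case: (chi_char) => per mul sq prim.
case cop_k: (coprimez k D).
  have kk : (chi k)%:~R * (chi k)%:~R = 1 :> K.
    by rewrite -intrM -expr2 sq cop_k.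
  have per1 : zperiodic D (fun a => (chi a)%:~R * z ^ a).
    by move=> a b /(zperiodic_gauss 1); rewrite !mul1r.
  rewrite /gauss_sum -(sum_residues_scale per1 cop_k) mulr_sumr.
  by apply: eq_bigr => a _; rewrite mul intrM !mulrA kk mul1r.
have -> : chi k = 0 by apply/eqP; rewrite char_eq0 cop_k.
rewrite mul0r; set S := \sum_(a < D) _.
have [p p_pr /andP[p_k p_D]] : exists2 p, prime p & (p %| `|k|)%N && (p %| D)%N.
  move: cop_k; rewrite coprimezE /coprime -[`|D%:Z|%N]/D => cop_k.
  have gcd_gt1 : (1 < gcdn `|k| D)%N.
    rewrite ltn_neqAle eq_sym cop_k /= gcdn_gt0.
    by rewrite (prim_order_gt0 prim_z) orbT.
  exists (pdiv (gcdn `|k| D)); first exact: pdiv_prime.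
  by rewrite -dvdn_gcd pdiv_dvd.
have [c c1 chi_c] := prim p p_pr p_D.
have cop_c : coprimez c D by rewrite char_coprime // chi_c.
have SN : S = - S.
  rewrite -{1}/S {1}/S -(sum_residues_scale (zperiodic_gauss k) cop_c) -sumrN.
  apply: eq_bigr => a _; rewrite mul chi_c mulN1r intrN mulNr.
  move: (nat_of_ord a) => {}a.
  congr (- (_ * _)); apply: (prim_exprz_periodic prim_z).
  have /dvdzP[k' ->] : (p%:Z %| k)%Z by rewrite dvdzE.
  case/dvdnP: p_D => D' eqD; move: c1.
  rewrite eqD mulnK ?prime_gt0 // => /dvdzP[t eq_c].
  apply/dvdzP; exists (k' * t * a%:Z); rewrite PoszM.
  have -> : c = t * D'%:Z + 1 by rewrite -eq_c subrK.
  by ring.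
apply/eqP; have /eqP : S *+ 2 = 0 by rewrite mulr2n {2}SN subrr.
by rewrite -mulr_natr mulf_eq0 (negPf two_neq0) orbF.
Qed.

(** Expanding one factor and twisting the other gives the double sum of [chi a * z ^ ((a + 1) * b)].
    The sum over [b] vanishes unless [D] divides [a + 1], which leaves only [a = D - 1]. *)
Lemma gauss_sum_sqr : gauss_sum ^+ 2 = (chi (- 1) * D%:Z)%:~R.
Proof.
have D_gt0 := prim_order_gt0 prim_z; case: chi_char => per _ _ _.
have lt_D1 : (D.-1 < D)%N by rewrite prednK.
rewrite expr2 {2}/gauss_sum mulr_sumr.
pose f (b a : 'I_D) : K := (chi a%:Z)%:~R * z ^ ((a%:Z + 1) * b%:Z).
rewrite (eq_bigr (fun b => \sum_a f b a)); last first.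
  move=> b _; rewrite mulrA [gauss_sum * _]mulrC -gauss_sum_twist mulr_suml.
  apply: eq_bigr => a _; rewrite /f -mulrA -expfzDr ?(prim_root_neq0 prim_z) //.
  by congr (_ * z ^ _); ring.
rewrite exchange_big /= (bigD1 (Ordinal lt_D1)) //= [X in _ + X]big1 ?addr0 => [|a ne_a].
  rewrite /f -mulr_sumr (sum_prim_exprz prim_z).
  have -> : D.-1%:Z + 1 = D%:Z by lia.
  rewrite dvdzz intrM; congr (_%:~R * _); apply: per.
  by apply/dvdzP; exists 1 => /=; lia.
rewrite /f -mulr_sumr (sum_prim_exprz prim_z) ifF ?mulr0 //.
apply: contraNF ne_a => /dvdzP[q eq_a]; rewrite -val_eqE /=.
have := ltn_ord a; have q1 : q = 1 by have := ltn_ord a; nia.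
by rewrite q1 in eq_a; lia.
Qed.

End Gauss.
End CharacterValues.

(** * The Legendre symbol and reciprocity *)

(** Serves over an algebraic closure of ['F_q], for reciprocity, and over [R[i]], for the
    spectrum. *)
Lemma exists_prim_root (K : closedFieldType) (n : nat) :
  n%:R != 0 :> K -> exists z : K, n.-primitive_root z.
Proof.
move=> n_neq0; have n_gt0 : (0 < n)%N by case: n n_neq0 => //; rewrite eqxx.
have [r def_r] := closed_field_poly_normal ('X^n - 1 : {poly K}).
rewrite (monicP (monic_Xn_sub_1 _ n_gt0)) scale1r in def_r.
have sz_r : size r = n.
  by apply: succn_inj; rewrite -(size_Xn_sub_1 K n_gt0) def_r size_prod_XsubC.
have/hasP[z _ prim_z] : has n.-primitive_root r.
  apply: has_prim_root; rewrite ?sz_r //.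
    by apply/allP => z rz; rewrite /root_of_unity def_r root_prod_XsubC.
  by rewrite -separable_prod_XsubC -def_r separable_Xn_sub_1.
by exists z.
Qed.

Lemma intr_eq0_pchar (K : nzRingType) (q : nat) (a : int) :
  q \in [pchar K] -> (a%:~R == 0 :> K) = (q%:Z %| a)%Z.
Proof.
move=> qK; case: a => a; first by rewrite dvdzE /= (dvdn_pcharf qK).
by rewrite dvdzE /= (dvdn_pcharf qK) NegzE intrN oppr_eq0.
Qed.

Lemma intr_eq_pchar (K : nzRingType) (q : nat) (a b : int) :
  q \in [pchar K] -> (a%:~R == b%:~R :> K) = (a == b %[mod q%:Z])%Z.
Proof. by move=> qK; rewrite -subr_eq0 -intrB (intr_eq0_pchar _ qK) eqz_mod_dvd. Qed.

Section Legendre.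
Variable q : nat.
Hypothesis q_pr : prime q.
Let qF := pchar_Fp q_pr.

Definition Fp_square (x : 'F_q) : bool := [exists y : 'F_q, y ^+ 2 == x].

Lemma legendreE (a : int) :
  legendre a q = if a%:~R == 0 :> 'F_q then 0
                 else if Fp_square a%:~R then 1 else -1.
Proof.
rewrite /legendre (intr_eq0_pchar _ qF); case: ifP => // _.
congr (if _ then _ else _); apply/existsP/existsP => [[x x2]|[y /eqP y2]].
  exists (x : nat)%:R; rewrite pmulrn -rmorphXn /=.
  by rewrite (intr_eq_pchar _ _ qF).
have lt_y : (y < q)%N by rewrite -[X in (_ < X)%N](Fp_cast q_pr) ltn_ord.
exists (Ordinal lt_y); rewrite -(intr_eq_pchar _ _ qF) rmorphXn /=.
by rewrite -pmulrn natr_Zp y2.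
Qed.

Lemma legendre_congr : zperiodic q (fun a => legendre a q).
Proof.
move=> a b; rewrite -eqz_mod_dvd -(intr_eq_pchar _ _ qF) => /eqP eq_ab.
by rewrite !legendreE eq_ab.
Qed.

Lemma legendre_sqr (a : int) : legendre a q ^+ 2 = (coprimez a q)%:R.
Proof.
rewrite coprimez_sym coprimezE prime_coprime //= -[(q %| _)%N]/(q%:Z %| a)%Z.
by rewrite /legendre; case: ifP => //= _; case: ifP.
Qed.

Lemma Fp_expf_pred (x : 'F_q) : x != 0 -> x ^+ q.-1 = 1.
Proof.
move=> x_neq0; apply: (mulfI x_neq0).
by rewrite -exprS prednK ?prime_gt0 // -[X in x ^+ X]card_Fp // expf_card mulr1.
Qed.

Lemma Fp_prim_root : exists g : 'F_q, q.-1.-primitive_root g.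
Proof.
have q1_gt0 : (0 < q.-1)%N by case: q q_pr => [|[]].
have /hasP[g _ prim_g] : has q.-1.-primitive_root (enum (predC1 (0 : 'F_q))).
  apply: has_prim_root; rewrite ?enum_uniq //.
    apply/allP => x; rewrite mem_enum => x_neq0.
    by apply/unity_rootP; exact: Fp_expf_pred.
  by rewrite -cardE; have := cardC1 (0 : 'F_q); rewrite card_Fp // => ->.
by exists g.
Qed.

Hypothesis q_odd : odd q.

(** As [q.-1] is even, the exponent of a power of [g] has a well-defined parity. Multiplicativity of
    the Legendre symbol thus becomes addition of parities. *)
Lemma Fp_square_prim_root (g : 'F_q) (i : nat) :
  q.-1.-primitive_root g -> Fp_square (g ^+ i) = ~~ odd i.
Proof.
have q1_even : odd q.-1 = false.
  by case: q q_odd => //= q' /negbTE.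
move=> prim_g; apply/existsP/idP => [[y /eqP y2]|ev_i]; last first.
  by exists (g ^+ i./2); rewrite -exprM muln2 even_halfK.
have y_neq0 : y != 0.
  apply/eqP => y0; move/eqP: y2; rewrite y0 expr0n /= eq_sym expf_eq0.
  rewrite (prim_root_eq0 prim_g) => /andP[_] /eqP q0.
  by have := prim_order_gt0 prim_g; rewrite q0.
have [j eq_y] := prim_rootP prim_g (Fp_expf_pred y_neq0).
move/eqP: y2; rewrite eq_y -exprM (eq_prim_root_expr prim_g) => /eqP eqm.
have := congr1 odd eqm.
by rewrite !odd_mod // muln2 odd_double => <-.
Qed.

Lemma legendreM (a b : int) : legendre (a * b) q = legendre a q * legendre b q.
Proof.
have [g prim_g] := Fp_prim_root.
rewrite !legendreE intrM mulf_eq0.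
have [|a0] /= := eqVneq; first by rewrite mul0r.
have [|b0] /= := eqVneq; first by rewrite mulr0.
have [i ->] := prim_rootP prim_g (Fp_expf_pred a0).
have [j ->] := prim_rootP prim_g (Fp_expf_pred b0).
rewrite -exprD !Fp_square_prim_root // oddD.
by case: odd; case: odd.
Qed.

Lemma legendre_nonresidue : exists c : int, legendre c q = -1.
Proof.
have [g prim_g] := Fp_prim_root; exists (g : nat)%:Z; rewrite legendreE.
rewrite -pmulrn natr_Zp -[g]expr1 Fp_square_prim_root // expr1.
rewrite (prim_root_eq0 prim_g) -leqn0 leqNgt (prim_order_gt0 prim_g) /=.
by [].
Qed.

Lemma legendre_character : quadratic_character q (fun a => legendre a q).
Proof.
split; [exact: legendre_congr | exact: legendreM | exact: legendre_sqr |].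
(* Here [D %/ p] is 1, so any nonresidue witnesses primitivity. *)
move=> p p_pr; rewrite dvdn_prime2 // => /eqP->.
have [c c1] := legendre_nonresidue; exists c => //.
by rewrite divnn prime_gt0 // dvd1z.
Qed.

(* In characteristic [q], Frobenius multiplies the Gauss sum [tau] by [chi q];
   it fixes [tau], a square root of [chi (- 1) * D], iff [tau] is in 'F_q. *)
Lemma character_reciprocity (D : nat) (chi : int -> int) :
    quadratic_character D chi -> ~~ (q %| D)%N ->
  chi q%:Z = legendre (chi (- 1) * D%:Z) q.
Proof.
move=> chi_char ndvd_qD; set Delta := _ * _.
have [K [iota _]] := countable_algebraic_closure 'F_q.
have qK : q \in [pchar K] by rewrite (fmorph_pchar iota).
have D_neq0 : D%:R != 0 :> K by rewrite -(dvdn_pcharf qK).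
have [z prim_z] := exists_prim_root D_neq0.
have two_neq0 : 2%:R != 0 :> K.
  rewrite -(dvdn_pcharf qK) dvdn_prime2 //.
  by apply: contraL q_odd => /eqP->.
have tau2 := gauss_sum_sqr chi_char prim_z two_neq0.
set tau := gauss_sum D chi z in tau2; rewrite -/Delta in tau2.
have cop_q : coprimez q%:Z D by rewrite coprimezE prime_coprime.
have Delta_neq0 : Delta%:~R != 0 :> 'F_q.
  rewrite (intr_eq0_pchar _ qF) dvdzE abszM Euclid_dvdM // (negPf ndvd_qD) orbF.
  have : coprimez (-1) D by rewrite coprimeNz coprimezE coprime1n.
  by case/(char_val chi_char) => ->; rewrite dvdn1; case: q q_pr => [|[]].
have frob_tau : tau ^+ q = (chi q%:Z)%:~R * tau.
  rewrite -(gauss_sum_twist chi_char prim_z two_neq0) -(pFrobenius_autE qK).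
  rewrite rmorph_sum; apply: eq_bigr => a _; rewrite rmorphM rmorph_int /=.
  by rewrite pFrobenius_autE -exprnP -exprM mulnC.
have tau_neq0 : tau != 0.
  apply: contraNneq Delta_neq0 => tau0; move/eqP: tau2.
  by rewrite tau0 expr0n /= eq_sym -(rmorph_int iota) fmorph_eq0.
rewrite legendreE (negPf Delta_neq0).
have iotaq x : iota x ^+ q = iota x.
  by rewrite -rmorphXn -[X in x ^+ X](card_Fp q_pr) expf_card.
case: ifPn => [/existsP[x /eqP x2]|nsq].
  have : tau ^+ q = tau.
    have : iota x ^+ 2 == tau ^+ 2 by rewrite tau2 -rmorphXn x2 rmorph_int.
    rewrite eqf_sqr => /orP[] /eqP eq_x; first by rewrite -eq_x iotaq.
    by apply/eqP; rewrite -[tau]opprK -eq_x -rmorphN iotaq.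
  rewrite frob_tau -{2}[tau]mul1r => /(mulIf tau_neq0) chi_q.
  have [//|chi_qN] := char_val chi_char cop_q.
  move/eqP: chi_q; rewrite chi_qN intrN -subr_eq0 -opprD oppr_eq0.
  by rewrite -[_ + _]/(2%:R) (negPf two_neq0).
have [chi_q|//] := char_val chi_char cop_q; case/negP: nsq.
(* Since ['X^q - 'X] splits over ['F_q], an element fixed by Frobenius comes from ['F_q]; its
   preimage is the required square root. *)
have : root (map_poly iota ('X^q - 'X)) tau.
  by rewrite rmorphB /= map_polyXn map_polyX rootE !hornerE frob_tau chi_q
             mul1r subrr.
rewrite -[X in 'X^X](card_Fp q_pr) finField_genPoly rmorph_prod /= rootE.
rewrite horner_prod prodf_seq_eq0 => /hasP[x _ /=].
rewrite map_polyXsubC hornerXsubC subr_eq0 => /eqP eq_tau.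
apply/existsP; exists x; rewrite -(inj_eq (fmorph_inj iota)).
by rewrite rmorphXn -eq_tau tau2 rmorph_int.
Qed.

End Legendre.

(** * Quadratic characters of given conductor *)

(** For primitivity at a prime of one factor, the Chinese remainder theorem lifts the witness of
    that factor to be 1 modulo the other. The helper [prim_l] is used with the factors in both
    orders. *)
Lemma quadratic_characterM (D1 D2 : nat) (chi1 chi2 : int -> int) :
    coprime D1 D2 -> quadratic_character D1 chi1 -> quadratic_character D2 chi2 ->
  quadratic_character (D1 * D2) (fun a => chi1 a * chi2 a).
Proof.
have prim_l E1 E2 (psi1 psi2 : int -> int) (p : nat) : coprime E1 E2 ->
    quadratic_character E1 psi1 -> quadratic_character E2 psi2 ->
    prime p -> (p %| E1)%N ->
  exists2 c : int, ((E1 * E2 %/ p)%:Z %| c - 1)%Z & psi1 c * psi2 c = -1.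
- move=> cop12 psi1_char psi2_char p_pr p_E1.
  case: (psi1_char) => per1 _ _ /(_ p p_pr p_E1)[c c1 psi_c].
  case: (psi2_char) => per2 _ _ _; pose d := zchinese E1 E2 c 1.
  have d_c : (E1%:Z %| d - c)%Z.
    by rewrite -eqz_mod_dvd; apply/eqP; exact: zchinese_modl.
  have d_1 : (E2%:Z %| d - 1)%Z.
    by rewrite -eqz_mod_dvd; apply/eqP; exact: zchinese_modr.
  exists d; last by rewrite (per1 _ _ d_c) (per2 _ _ d_1) psi_c (char1 psi2_char).
  rewrite -divn_mulAC // PoszM Gauss_dvdz ?d_1 ?andbT; last first.
    by rewrite coprimezE; apply: coprime_dvdl cop12; exact: dvdn_div.
  have -> : d - 1 = (d - c) + (c - 1) by ring.
  rewrite rpredD //; apply: dvdz_trans d_c.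
  by rewrite dvdzE; exact: dvdn_div.
move=> cop12 chi1_char chi2_char.
case: (chi1_char) => per1 mul1 sq1 _; case: (chi2_char) => per2 mul2 sq2 _.
split.
- move=> a b dvd_ab; congr (_ * _).
    by apply: per1; apply: dvdz_trans dvd_ab; rewrite PoszM dvdz_mulr.
  by apply: per2; apply: dvdz_trans dvd_ab; rewrite PoszM dvdz_mull.
- by move=> a b; rewrite mul1 mul2 mulrACA.
- by move=> a; rewrite exprMn sq1 sq2 PoszM coprimezMr; do 2?case: coprimez.
- move=> p p_pr; rewrite Euclid_dvdM // => /orP[] p_D.
    exact: prim_l p_D.
  have cop21 : coprime D2 D1 by rewrite coprime_sym.
  have [c c1 chi_c] := prim_l _ _ _ _ p cop21 chi2_char chi1_char p_pr p_D.
  by exists c; [rewrite mulnC | rewrite mulrC].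
Qed.

Lemma quadratic_character1 : quadratic_character 1 (fun=> 1).
Proof.
split=> // [a|p p_pr]; last by rewrite dvdn1; case: p p_pr => [|[]].
by rewrite expr1n coprimezE coprimen1.
Qed.

Definition chi4 (a : int) : int :=
  if (2 %| a)%Z then 0 else if (a == 1 %[mod 4])%Z then 1 else -1.

(** The symbol at 2 as a function of its upper argument is the even primitive character modulo 8. *)
Local Notation chi8 := (kronecker_prime^~ 2%N).

Lemma chi4_periodic : zperiodic 4 chi4.
Proof.
move=> a b dvd_ab; rewrite /chi4.
have -> : (2 %| a)%Z = (2 %| b)%Z by apply/idP/idP; lia.
by have -> : (a == 1 %[mod 4])%Z = (b == 1 %[mod 4])%Z by apply/idP/idP; lia.
Qed.

Lemma chi8_periodic : zperiodic 8 chi8.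
Proof.
move=> a b dvd_ab; rewrite /kronecker_prime /=.
have -> : (2 %| a)%Z = (2 %| b)%Z by apply/idP/idP; lia.
have -> : (a == 1 %[mod 8])%Z = (b == 1 %[mod 8])%Z by apply/idP/idP; lia.
by have -> : (a == -1 %[mod 8])%Z = (b == -1 %[mod 8])%Z by apply/idP/idP; lia.
Qed.

(** Every integer is congruent modulo [D] to one of 0, ..., 7, so the identities are finite checks;
    2 is the only prime factor of [D], so one witness [c] gives primitivity. *)
Lemma quadratic_character_2part (D : nat) (chi : int -> int) (c : int) :
    (D %| 8)%N -> (1 < D)%N -> zperiodic D chi ->
    all (fun i => all (fun j : nat => chi (i%:Z * j%:Z) == chi i * chi j)
                      (iota 0 8)) (iota 0 8) ->
    all (fun i : nat => chi i ^+ 2 == (coprimez i D)%:R) (iota 0 8) ->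
    ((D %/ 2)%:Z %| c - 1)%Z -> chi c = -1 ->
  quadratic_character D chi.
Proof.
move=> D8 D_gt1 per chk_mul chk_sq c1 chi_c.
have res (a : int) : exists2 i : nat, i \in iota 0 8 & (D%:Z %| a - i%:Z)%Z.
  exists `|(a %% 8)%Z|%N; first by rewrite mem_iota; lia.
  apply: (@dvdz_trans 8); first by rewrite dvdzE.
  lia.
split=> // [a b|a|p p_pr p_D].
- have [i i8 ai] := res a; have [j j8 bj] := res b.
  rewrite (per _ _ ai) (per _ _ bj) -(eqP (allP (allP chk_mul i i8) j j8)).
  apply: per; have -> : a * b - i%:Z * j%:Z = b * (a - i%:Z) + i%:Z * (b - j%:Z).
    by ring.
  by rewrite rpredD // dvdz_mull.
- have [i i8 ai] := res a.
  by rewrite (per _ _ ai) (coprimez_congr ai) (eqP (allP chk_sq i i8)).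
- have : (p %| 2 ^ 3)%N := dvdn_trans p_D D8.
  by rewrite Euclid_dvdX // dvdn_prime2 // => /andP[/eqP-> _]; exists c.
Qed.

Lemma chi4_character : quadratic_character 4 chi4.
Proof. by apply: (@quadratic_character_2part _ _ 3) => //; exact: chi4_periodic. Qed.

Lemma chi8_character : quadratic_character 8 chi8.
Proof. by apply: (@quadratic_character_2part _ _ 5) => //; exact: chi8_periodic. Qed.

Lemma chi48_character : quadratic_character 8 (fun a => chi4 a * chi8 a).
Proof.
apply: (@quadratic_character_2part _ _ 5) => // a b dvd_ab.
rewrite (chi8_periodic dvd_ab) (@chi4_periodic a b) //.
by apply: dvdz_trans dvd_ab.
Qed.

Lemma legendre_sqrE (p : nat) (a : int) : prime p -> odd p ->
  ~~ (p%:Z %| a)%Z -> legendre (a * a) p = 1.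
Proof.
move=> p_pr p_odd ndvd; rewrite legendreM // -expr2 legendre_sqr //.
by rewrite coprimez_sym coprimezE prime_coprime // -dvdzE ndvd.
Qed.

Lemma odd_prime_ndvd2 (p : nat) : prime p -> odd p -> ~~ (p %| 2)%N.
Proof. by move=> p_pr; rewrite dvdn_prime2 //; apply: contraL => /eqP->. Qed.

(** First supplementary law: reciprocity for [chi4] gives the symbol of -4, and the square 4 drops
    out. *)
Lemma legendreN1 (p : nat) : prime p -> odd p -> legendre (-1) p = chi4 p.
Proof.
move=> p_pr p_odd; have p2 := odd_prime_ndvd2 p_pr p_odd.
rewrite (character_reciprocity p_pr p_odd chi4_character); last first.
  by rewrite -[4%N]/(2 * 2)%N Euclid_dvdM // negb_or p2.
have -> : chi4 (-1) * 4%N%:Z = -1 * (2 * 2) by [].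
by rewrite [RHS]legendreM // legendre_sqrE ?mulr1.
Qed.

(** Second supplementary law: reciprocity for [chi8] gives the symbol of 8, which is 2 times a
    square. *)
Lemma legendre2 (p : nat) : prime p -> odd p -> legendre 2 p = chi8 p.
Proof.
move=> p_pr p_odd; have p2 := odd_prime_ndvd2 p_pr p_odd.
rewrite (character_reciprocity p_pr p_odd chi8_character); last first.
  by rewrite -[8%N]/(2 * 2 * 2)%N !Euclid_dvdM // !negb_or p2.
have -> : chi8 (-1) * 8%N%:Z = 2 * (2 * 2) by [].
by rewrite [RHS]legendreM // legendre_sqrE ?mulr1.
Qed.

Definition squarefreen (n : nat) : Prop :=
  forall d : nat, (d ^ 2 %| n)%N -> d = 1%N.

Lemma squarefreenMl (m n : nat) : squarefreen (m * n) -> squarefreen m.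
Proof. by move=> sqf d dm; apply: sqf; exact: dvdn_mulr. Qed.

Lemma squarefreenMr (m n : nat) : squarefreen (m * n) -> squarefreen n.
Proof. by rewrite mulnC; exact: squarefreenMl. Qed.

Lemma squarefreen_prime_coprime (p n : nat) :
  prime p -> squarefreen (p * n) -> coprime p n.
Proof.
move=> p_pr sqf; rewrite prime_coprime //; apply/negP => p_n.
have p1 : p = 1%N by apply: sqf; rewrite expnS expn1 dvdn_pmul2l ?prime_gt0.
by rewrite p1 in p_pr.
Qed.

(** The character is the product of the Legendre symbols at the primes of [M]. Its value at -1
    decides later which 2-part makes the full character even; its value at 2 is the Kronecker symbol
    at 2. *)
Lemma odd_squarefree_character (M : nat) : odd M -> squarefreen M ->
  exists chi, [/\ quadratic_character M chi, chi (-1) = chi4 M & chi 2 = chi8 M].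
Proof.
have [n] := ubnP M; elim: n M => // n IHn M lt_Mn odd_M sqf_M.
have [M1|M_neq1] := eqVneq M 1%N.
  by exists (fun=> 1); rewrite M1; split=> //; exact: quadratic_character1.
have M_gt1 : (1 < M)%N by case: M M_neq1 odd_M {lt_Mn sqf_M} => [|[]].
have p_pr := pdiv_prime M_gt1; set p := pdiv M in p_pr.
have [N eqM] : exists N, M = (p * N)%N.
  by have /dvdnP[N ->] := pdiv_dvd M; exists N; rewrite mulnC.
rewrite {}eqM in lt_Mn odd_M sqf_M *; move: p p_pr => {}p p_pr in lt_Mn odd_M sqf_M *.
move: odd_M; rewrite oddM => /andP[p_odd odd_N].
have [|psi [psi_char psiN1 psi2]] := IHn N _ odd_N (squarefreenMr sqf_M).
  rewrite -ltnS; apply: leq_trans lt_Mn.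
  by rewrite ltnS ltn_Pmull ?prime_gt1 // odd_gt0.
exists (fun a => legendre a p * psi a); split.
- apply: quadratic_characterM psi_char; last exact: legendre_character.
  exact: squarefreen_prime_coprime.
- by rewrite legendreN1 // psiN1 PoszM; case: chi4_character => _ ->.
- by rewrite legendre2 // psi2 PoszM; case: chi8_character => _ ->.
Qed.

(** * Positive discriminants and their Kronecker symbols *)

Variant discriminant_spec (D M : nat) : Prop :=
  | DiscriminantOdd of D = M & M = 1 %[mod 4] & (1 < M)%N
  | DiscriminantFour of D = (4 * M)%N & M = 3 %[mod 4]
  | DiscriminantEight of D = (8 * M)%N.

(** Here [M] is [m] when [m] is odd and [m / 2] when [m] is even; squarefreeness makes the latter
    odd. *)
Lemma quad_discP (m : int) : squarefree m -> m <> 1 -> 0 < quad_disc m ->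
  exists M : nat, [/\ odd M, squarefreen M & discriminant_spec `|quad_disc m| M].
Proof.
case: m => m sqf m_neq1; last first.
  rewrite /quad_disc; case: ifP => //; lia.
have {}m_neq1 : m <> 1%N by move=> m1; apply: m_neq1; rewrite m1.
have {sqf} sqf_m : squarefreen m by move=> d /sqf.
rewrite /quad_disc; case: ifP => [m1 m_gt0|m1 m_gt0].
  exists m; split => //; first by lia.
  by constructor 1 => //; lia.
case odd_m: (odd m).
  by exists m; split=> //; constructor 2; lia.
have [M eqm] : exists M, m = (2 * M)%N by exists m./2; lia.
rewrite {m}eqm in sqf_m odd_m m_neq1 m1 m_gt0 *.
have odd_M : odd M.
  rewrite -coprime2n; exact: squarefreen_prime_coprime.
exists M; split => //; first exact: squarefreenMr sqf_m.
by constructor 3; lia.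
Qed.

(** Both sides vanish at primes dividing [D], and reciprocity settles the other odd primes. The
    prime 2 lies outside reciprocity, hence the hypothesis on [chi 2]. *)
Lemma kronecker_prime_character (D : nat) (chi : int -> int) (p : nat) :
    quadratic_character D chi -> chi (-1) = 1 ->
    (odd D -> chi 2 = chi8 D) -> prime p ->
  kronecker_prime D p = chi p.
Proof.
move=> chi_char chiN1 chi2 p_pr; have [p_D|p_D] := boolP (p %| D)%N.
  have -> : chi p = 0.
    apply/eqP; rewrite (char_eq0 chi_char) coprimezE /= prime_coprime //.
    by rewrite negbK.
  have {}p_D : (p%:Z %| D%:Z)%Z by rewrite dvdzE.
  rewrite /kronecker_prime /legendre p_D.
  by case: eqP => [p2|//]; rewrite p2 in p_D; rewrite p_D.
have [p2|p_neq2] := eqVneq p 2%N.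
  by rewrite p2 in p_D *; rewrite chi2 // -[odd D]negbK -dvdn2.
rewrite /kronecker_prime (negPf p_neq2).
have p_odd : odd p by case: (even_prime p_pr) p_neq2 => // ->.
by rewrite (character_reciprocity p_pr p_odd chi_char p_D) chiN1 mul1r.
Qed.

(** Both sides are multiplicative, so primes suffice. Signs agree as [D] is positive and
    [chi (-1) = 1]; at [b = 0] both sides are 0 because [D] exceeds 1. *)
Lemma kroneckerE (D : nat) (chi : int -> int) :
    quadratic_character D chi -> chi (-1) = 1 ->
    (odd D -> chi 2 = chi8 D) -> (1 < D)%N ->
  kronecker D =1 chi.
Proof.
move=> chi_char chiN1 chi2 D_gt1 b; rewrite /kronecker.
case: (chi_char) => _ mul _ _; case: eqP => [->|/eqP b_neq0].
  case: eqP => [|_]; first by lia.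
  apply/esym/eqP; rewrite (char_eq0 chi_char) coprimezE /coprime gcd0n.
  by rewrite -[`|D%:Z|%N]/D neq_ltn D_gt1 orbT.
rewrite ltNge lez_nat /= mul1r.
have chi_abs : chi `|b|%N = chi b.
  by case: b {b_neq0} => // n; rewrite NegzE abszN -mulN1r mul chiN1 mul1r.
rewrite -chi_abs {2}[`|b|%N]prod_prime_decomp ?lt0n ?absz_eq0 //.
rewrite (big_morph (fun n : nat => chi n) (id1 := 1) (op1 := *%R)); last first.
- exact: char1 chi_char.
- by move=> x y; rewrite PoszM mul.
rewrite !big_seq; apply: eq_bigr => -[p e] /=.
move=> /mem_prime_decomp[p_pr _ _].
rewrite (kronecker_prime_character chi_char) //.
elim: e => [|e IHe]; first by rewrite expr0 expn0 (char1 chi_char).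
by rewrite exprS expnS PoszM mul IHe.
Qed.

(** The 2-part is chosen to make the product even: the odd part takes the value [chi4 M] at -1, so
    [M = 1] modulo 4 calls for no 2-part or [chi8], and [M = 3] for [chi4] or [chi4 * chi8]. *)
Lemma discriminant_character (D M : nat) :
    odd M -> squarefreen M -> discriminant_spec D M ->
  exists2 chi, quadratic_character D chi
    & chi (-1) = 1 /\ (odd D -> chi 2 = chi8 D).
Proof.
move=> odd_M sqf_M; have [psi [psi_char psiN1 psi2]] :=
  odd_squarefree_character odd_M sqf_M.
have cop2 k : coprime (2 ^ k) M by rewrite coprimeXl // coprime2n.
case=> [-> M1 _|-> M3|->].
- exists psi => //; split=> //; rewrite psiN1 /chi4 ifF; last by lia.
  by rewrite ifT //; lia.
- exists (fun a => chi4 a * psi a).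
    exact: (quadratic_characterM (cop2 2%N) chi4_character psi_char).
  split; last by rewrite oddM.
  rewrite psiN1 /chi4 /= ifF; last by lia.
  by rewrite ifF //; lia.
- have [M1|M1] := boolP (M == 1 %[mod 4])%N.
    exists (fun a => chi8 a * psi a).
      exact: (quadratic_characterM (cop2 3%N) chi8_character psi_char).
    split; last by rewrite oddM.
    rewrite psiN1 /chi4 ifF; last by lia.
    by rewrite ifT //; lia.
  exists (fun a => chi4 a * chi8 a * psi a).
    exact: (quadratic_characterM (cop2 3%N) chi48_character psi_char).
  split; last by rewrite oddM.
  rewrite psiN1 /chi4 /= ifF; last by lia.
  by rewrite ifF //; lia.
Qed.

(** * Eigenvalues of circulant graphs *)

Lemma sum_residues_reflect (V : nmodType) (D : nat) (F : int -> V) (t : int) :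
    zperiodic D F ->
  \sum_(a < D) F (t - a%:Z) = \sum_(a < D) F a%:Z.
Proof.
move=> perF; apply: (sum_residues_reindex (h := fun a => t - a)) => // a b.
have -> : a - b = - (t - a - (t - b)) by ring.
by rewrite rpredN.
Qed.

Section Circulant.
Variables (K : fieldType) (D : nat) (z : K) (f : int -> K).
Hypotheses (prim_z : D.-primitive_root z) (f_per : zperiodic D f).

Let zD (a b : int) : z ^ (a + b) = z ^ a * z ^ b.
Proof. by rewrite expfzDr // (prim_root_neq0 prim_z). Qed.

Let zf_per (k : int) : zperiodic D (fun a => f a * z ^ (k * a)).
Proof.
by move=> a b dvd_ab; rewrite (f_per dvd_ab) (prim_exprz_congr prim_z k dvd_ab).
Qed.

Definition dft (k : int) : K := \sum_(a < D) f a%:Z * z ^ (k * a%:Z).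

(** The Fourier transform [w] of a left eigenvector [v] turns convolution with [f] into
    multiplication by [dft k], so [x = dft k] wherever [w k] is nonzero. *)
Lemma circulant_eigenvalue (x : K) :
  eigenvalue (\matrix_(i < #|'I_D|, j < #|'I_D|)
                 f ((enum_val j : nat)%:Z - (enum_val i : nat)%:Z)) x
  <-> exists k : 'I_D, x = dft k.
Proof.
set A := \matrix_(i, j) _; split=> [/eigenvalueP[v vA v_neq0]|[k ->]].
  pose w (k : int) := \sum_i v 0 i * z ^ (k * (enum_val i : nat)%:Z).
  have xw k : x * w k = dft k * w k.
    have -> : x * w k = \sum_j (v *m A) 0 j * z ^ (k * (enum_val j : nat)%:Z).
      rewrite vA mulr_sumr; apply: eq_bigr => j _.
      by rewrite mxE mulrA.
    under eq_bigr do rewrite mxE mulr_suml.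
    rewrite exchange_big mulr_sumr; apply: eq_bigr => i _ /=.
    rewrite mulrCA; under eq_bigr do rewrite mxE -mulrA.
    rewrite -mulr_sumr; congr (_ * _).
    rewrite -(big_enum_val (fun j : 'I_D =>
      f (j%:Z - (enum_val i : nat)%:Z) * z ^ (k * j%:Z))) /=.
    move: (nat_of_ord (enum_val i)) => {}i.
    rewrite /dft -(sum_residues_shift (- i%:Z) (zf_per k)) mulr_suml.
    apply: eq_bigr => j _; rewrite -mulrA -zD.
    by congr (_ * z ^ _); ring.
  have [/existsP[k wk]|/existsPn w0] := boolP [exists k : 'I_D, w k != 0].
    by exists k; apply: (mulIf wk); exact: xw.
  (* If [w] vanished identically, Fourier inversion at [i0] would make [D] times a nonzero entry of
     [v] vanish. *)
  case/rV0Pn: v_neq0 => i0 /negP[]; have := prim_root_natf_neq0 prim_z.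
  move=> D_neq0; apply/eqP; apply: (mulIf D_neq0); rewrite mul0r.
  have sum0 : \sum_(k < D) w k * z ^ (- k%:Z * (enum_val i0 : nat)%:Z) = 0.
    by apply: big1 => k _; have := w0 k; rewrite negbK => /eqP->; rewrite mul0r.
  rewrite -[RHS]sum0; under [RHS]eq_bigr do rewrite mulr_suml.
  rewrite exchange_big (bigD1 i0) //= [X in _ + X]big1 ?addr0 => [|i ne_i].
    rewrite (eq_bigr (fun=> v 0 i0)) ?big_const_ord ?iter_addr_0 ?mulr_natr //.
    by move=> k _; rewrite -mulrA -zD mulNr subrr mulr1.
  under eq_bigr => k _.
    rewrite -mulrA -zD.
    have -> : k%:Z * (enum_val i : nat)%:Z + - k%:Z * (enum_val i0 : nat)%:Z
      = ((enum_val i : nat)%:Z - (enum_val i0 : nat)%:Z) * k%:Z by ring.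
    over.
  rewrite -mulr_sumr (sum_prim_exprz prim_z) ifF ?mulr0 //.
  apply: contraNF ne_i; rewrite -eqz_mod_dvd !modz_small ?ltz_nat ?ltn_ord //.
  by move=> /eqP[] /val_inj /enum_val_inj ->.
(* Conversely, the additive character with exponent [- k] is a left eigenvector for [dft k]. *)
apply/eigenvalueP; exists (\row_(i < #|'I_D|) z ^ (- k%:Z * (enum_val i : nat)%:Z)).
  apply/rowP => j; rewrite !mxE /dft.
  under eq_bigr do rewrite !mxE.
  rewrite -(big_enum_val (fun i : 'I_D =>
      z ^ (- k%:Z * i%:Z) * f ((enum_val j : nat)%:Z - i%:Z))) /=.
  move: (nat_of_ord (enum_val j)) => {}j.
  have /= <- := sum_residues_reflect j (zf_per k); rewrite mulr_suml.
  under [RHS]eq_bigr do rewrite -mulrA -zD mulrC.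
  apply: eq_bigr => i _; congr (z ^ _ * _).
  by ring.
apply/rV0Pn; have D_gt0 := prim_order_gt0 prim_z.
exists (enum_rank (Ordinal D_gt0)); rewrite mxE enum_rankK /= mulr0.
exact: oner_neq0.
Qed.

End Circulant.

Lemma mem_eigenvalues (T : finType) (e : rel T) (R : rcfType) (x : R) :
  (x \in eigenvalues e R) = eigenvalue (adjacency e R) x.
Proof.
rewrite eigenvalue_root_char /eigenvalues -roots_on_rootsR ?inE //.
exact/monic_neq0/char_poly_monic.
Qed.

(** The list [eigenvalues] lives in [R] and the Fourier sums in [R[i]]; being an eigenvalue is
    invariant under the embedding of fields. *)
Lemma eigenvalues_circulant (R : rcfType) (D : nat) (z : R[i]) (f : int -> bool)
    (e : rel 'I_D) (x : R) :
    D.-primitive_root z -> zperiodic D f ->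
    (forall u v : 'I_D, e u v = f (v%:Z - u%:Z)) ->
  x \in eigenvalues e R <->
  exists k : 'I_D, (x%:C)%C = dft D z (fun a => (f a)%:R) k.
Proof.
move=> prim_z f_per eE; rewrite mem_eigenvalues.
rewrite -(eigenvalue_map (real_complex R)).
have fK_per : zperiodic D (fun a => (f a)%:R : R[i]) by move=> a b /f_per->.
have := circulant_eigenvalue prim_z fK_per (real_complex R x).
set A := \matrix_(i, j) _; suff -> : map_mx (real_complex R) (adjacency e R) = A.
  by [].
by apply/matrixP => i j; rewrite !mxE rmorph_nat eE.
Qed.

(** * Ramanujan sums *)

(** A Chinese remainder idempotent: multiplication by [c] makes an integer divisible by [m] without
    changing it modulo [n]. *)
Lemma coprime_idempotent (m n : nat) : coprime m n ->
  exists2 c : int, (m%:Z %| c)%Z & (n%:Z %| c - 1)%Z.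
Proof.
move=> cop_mn; exists (zchinese m n 0 1); last first.
  by rewrite -eqz_mod_dvd; apply/eqP; exact: zchinese_modr.
by rewrite -[zchinese _ _ _ _]subr0 -eqz_mod_dvd; apply/eqP; exact: zchinese_modl.
Qed.

Section RamanujanSum.
Variables (K : fieldType) (D : nat) (z : K).
Hypothesis prim_z : D.-primitive_root z.

Definition ramanujan_sum (k : int) : K :=
  \sum_(a < D) (coprimez a%:Z D)%:R * z ^ (k * a%:Z).

Let zD (a b : int) : z ^ (a + b) = z ^ a * z ^ b.
Proof. by rewrite expfzDr // (prim_root_neq0 prim_z). Qed.

Let term_per (k : int) :
  zperiodic D (fun a => (coprimez a D)%:R * z ^ (k * a)).
Proof.
by move=> a b ab; rewrite (coprimez_congr ab) (prim_exprz_congr prim_z k ab).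
Qed.

Lemma ramanujan_sum_congr : zperiodic D ramanujan_sum.
Proof.
move=> k l kl; apply: eq_bigr => a _; congr (_ * _).
by rewrite ![_ * a%:Z]mulrC; exact: (prim_exprz_congr prim_z a kl).
Qed.

Lemma ramanujan_sum0 : ramanujan_sum 0 = (totient D)%:R.
Proof.
rewrite totient_count_coprime big_mkord natr_sum; apply: eq_bigr => a _.
by rewrite mul0r expr0z mulr1 coprimezE coprime_sym.
Qed.

Lemma ramanujan_sum_dvd (k : int) :
  (D%:Z %| k)%Z -> ramanujan_sum k = (totient D)%:R.
Proof.
by move=> Dk; rewrite -ramanujan_sum0; apply: ramanujan_sum_congr; rewrite subr0.
Qed.

Lemma ramanujan_sum_scale (k c : int) :
  coprimez c D -> ramanujan_sum (k * c) = ramanujan_sum k.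
Proof.
move=> cop_c; rewrite /ramanujan_sum -[RHS](sum_residues_scale (term_per k) cop_c).
by apply: eq_bigr => a _; rewrite coprimezMl cop_c mulrA.
Qed.

(** Translation by [t] permutes the units and multiplies the sum by [z ^ (k * t)], which is not
    1. *)
Lemma ramanujan_sum_shift (k t : int) :
    (forall a, coprimez (a + t) D = coprimez a D) -> ~~ (D%:Z %| k * t)%Z ->
  ramanujan_sum k = 0.
Proof.
move=> cop_t; rewrite -(prim_exprz_eq1 prim_z) => zt.
have : (1 - z ^ (k * t)) * ramanujan_sum k = 0.
  apply/eqP; rewrite mulrBl mul1r subr_eq0; apply/eqP.
  rewrite {1}/ramanujan_sum -(sum_residues_shift t (term_per k)) mulr_sumr.
  by apply: eq_bigr => a _; rewrite cop_t mulrDr zD mulrA mulrC.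
by move/eqP; rewrite mulf_eq0 subr_eq0 eq_sym (negPf zt) => /eqP.
Qed.

(** The numbers [c + M * j] with [j < p] are 1 modulo [M] and run through all residues modulo [p].
    For [j > 0] they are units, which leave the sum at [k] unchanged; [j = 0] contributes the sum at
    [k * c]. *)
Lemma ramanujan_sum_prime (p M : nat) (k c : int) :
    prime p -> coprime p M -> D = (p * M)%N -> ~~ (p%:Z %| k)%Z ->
    (p%:Z %| c)%Z -> (M%:Z %| c - 1)%Z ->
  (p.-1)%:R * ramanujan_sum k = - ramanujan_sum (k * c).
Proof.
move=> p_pr cop_pM eqD p_k p_c M_c.
have p_gt0 := prime_gt0 p_pr.
have M_gt0 : (0 < M)%N.
  by move: (prim_order_gt0 prim_z); rewrite eqD muln_gt0 => /andP[].
have prim_zM : p.-primitive_root (z ^+ M).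
  have := dvdn_prim_root prim_z (m := p); rewrite eqD mulKn //; apply.
  exact: dvdn_mulr.
(* For each unit [a], the sum over [j] runs over all powers of a nontrivial [p]-th root of unity. *)
have sum0 : \sum_(j < p) ramanujan_sum (k * (c + M%:Z * j%:Z)) = 0.
  rewrite exchange_big big1 // => a _ /=; rewrite -mulr_sumr.
  have [cop_a|] := boolP (coprimez a%:Z D); last by rewrite mul0r.
  rewrite (eq_bigr (fun j : 'I_p =>
     z ^ (k * c * a%:Z) * (z ^+ M) ^ (k * a%:Z * j%:Z))); last first.
    by move=> j _; rewrite [z ^+ M]exprnP exprz_exp -zD; congr (z ^ _); ring.
  rewrite -mulr_sumr (sum_prim_exprz prim_zM) ifF ?mulr0 //; apply/negbTE.
  move: (nat_of_ord a) cop_a => {}a.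
  rewrite eqD PoszM coprimezMr coprimezE coprime_sym /=.
  rewrite prime_coprime // => /andP[p_a _].
  by rewrite dvdzE abszM Euclid_dvdM // negb_or -dvdzE p_k.
move: sum0; rewrite (bigD1 (Ordinal p_gt0)) //= mulr0 addr0.
rewrite (eq_bigr (fun=> ramanujan_sum k)); last first.
  move=> j; rewrite -val_eqE /= => j_neq0; apply: ramanujan_sum_scale.
  rewrite eqD PoszM coprimezMr; apply/andP; split.
    rewrite coprimez_sym coprimezE prime_coprime //= -[(p %| _)%N]/(p%:Z %| _)%Z.
    rewrite rpredDl // dvdzE abszM Euclid_dvdM // negb_or -prime_coprime // cop_pM.
    by rewrite /= gtnNdvd // ?lt0n.
  have dvd1 : (M%:Z %| c + M%:Z * j%:Z - 1)%Z.
    by rewrite addrAC rpredD // dvdz_mulr.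
  by rewrite (coprimez_congr dvd1) coprimezE coprime1n.
rewrite sumr_const cardC1 card_ord mulr_natl => /eqP.
by rewrite addrC addr_eq0 => /eqP.
Qed.

(** Here [z ^ k] is 1 or -1. In the latter case every term is -1, since units modulo an even [D] are
    odd. *)
Lemma ramanujan_sum_dvd2 (k : int) : 2%:R != 0 :> K -> (2 %| D)%N ->
  (D%:Z %| 2 * k)%Z -> ramanujan_sum k ^+ 2 = (totient D)%:R ^+ 2.
Proof.
move=> two_neq0 D_even; rewrite -(prim_exprz_eq1 prim_z) mulrC -exprz_exp.
rewrite -[_ ^ 2]/(_ ^+ 2) sqrf_eq1 => /orP[] /eqP zk.
  by rewrite ramanujan_sum_dvd // -(prim_exprz_eq1 prim_z) zk.
rewrite -ramanujan_sum0 -[RHS]sqrrN; congr (_ ^+ 2).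
rewrite /ramanujan_sum -sumrN; apply: eq_bigr => a _.
rewrite mul0r expr0z mulr1 -exprz_exp zk; case cop_a: coprimez; last first.
  by rewrite mul0r oppr0.
rewrite mul1r -[_ ^ _]/((-1) ^+ a) -signr_odd.
suff -> : odd a by rewrite expr1.
move: cop_a; rewrite coprimezE /= -coprime2n coprime_sym.
exact: coprime_dvdl.
Qed.

End RamanujanSum.

Lemma prim_root_norm1 (K : numFieldType) (D : nat) (z : K) (k : int) :
  D.-primitive_root z -> `|z ^ k| = 1.
Proof.
move=> prim_z; have D_gt0 := prim_order_gt0 prim_z.
have z1 : `|z| = 1.
  apply/eqP; rewrite -(@pexpr_eq1 _ _ D) // -normrX (prim_expr_order prim_z).
  by rewrite normr1.
case: k => k; first by rewrite -exprnP normrX z1 expr1n.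
by rewrite /exprz normfV normrX z1 expr1n invr1.
Qed.

Lemma ramanujan_sum_le (K : numFieldType) (D : nat) (z : K) (k : int) :
  D.-primitive_root z -> `|ramanujan_sum D z k| <= (totient D)%:R.
Proof.
move=> prim_z; apply: le_trans (ler_norm_sum _ _ _) _.
rewrite -(ramanujan_sum0 D z) le_eqVlt; apply/orP; left; apply/eqP.
apply: eq_bigr => a _; rewrite normrM normr_nat (prim_root_norm1 _ prim_z).
by rewrite mul0r expr0z.
Qed.

(** * The graph of a quadratic character *)

Section CharacterGraph.
Variables (R : rcfType) (D : nat) (chi : int -> int) (z : R[i]).
Variable e : rel 'I_D.
Hypotheses (chi_char : quadratic_character D chi) (chiN1 : chi (-1) = 1).
Hypotheses (D_gt1 : (1 < D)%N) (prim_z : D.-primitive_root z).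
Hypothesis eE : forall u v : 'I_D, e u v = (chi (v%:Z - u%:Z) == 1).

Local Notation C := R[i].
Local Notation phi := (totient D).
Local Notation tau := (gauss_sum D chi z).

Let two_neq0 : 2%:R != 0 :> C. Proof. by rewrite pnatr_eq0. Qed.

Let chi0 : chi 0 = 0.
Proof.
apply/eqP; rewrite (char_eq0 chi_char) coprimezE /coprime gcd0n /=.
by rewrite neq_ltn D_gt1 orbT.
Qed.

Let chiN (a : int) : chi (- a) = chi a.
Proof. by case: chi_char => _ mul _ _; rewrite -mulN1r mul chiN1 mul1r. Qed.

Let indic_per : zperiodic D (fun a => chi a == 1).
Proof. by case: chi_char => per _ _ _ a b /per ->. Qed.

(** Twice the indicator of [chi a = 1] is [chi a ^ 2 + chi a], and [chi a ^ 2] indicates coprimality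
    to [D]. *)
Lemma dft_indicator (k : int) :
  2%:R * dft D z (fun a => (chi a == 1)%:R) k =
  ramanujan_sum D z k + (chi k)%:~R * tau.
Proof.
rewrite -(gauss_sum_twist chi_char prim_z two_neq0) mulr_sumr -big_split.
apply: eq_bigr => a _ /=; rewrite mulrA -mulrDl; congr (_ * _).
have := char_eq0 chi_char a; case: (char_range chi_char a) => -> /=.
- by move=> /esym/negbTE->; rewrite mulr0 addr0.
- by move=> /esym/negbFE->; rewrite mulr1.
- by move=> /esym/negbFE->; rewrite mulr0 intrN subrr.
Qed.

Lemma character_degree : exists2 r : nat, (2 * r)%N = phi & regular e r.
Proof.
exists (\sum_(a < D) (chi a%:Z == 1))%N.
  apply/eqP; rewrite -(eqr_nat C) natrM natr_sum -(ramanujan_sum0 D z).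
  have := dft_indicator 0; rewrite chi0 mul0r addr0 => <-; apply/eqP.
  congr (_ * _); apply: eq_bigr => a _.
  by rewrite mul0r expr0z mulr1.
move=> u; have indic_nat : zperiodic D (fun a => (chi a == 1) : nat).
  by move=> a b /indic_per ->.
have /= <- := sum_residues_shift (- u%:Z) indic_nat.
rewrite -sum1_card big_mkcond; apply: eq_bigr => v _.
by rewrite inE eE; case: ifP.
Qed.

Lemma character_undirected : undirected e.
Proof.
split=> [u v|u]; last by rewrite eE subrr chi0.
by rewrite !eE -chiN opprB.
Qed.

(** Consecutive vertices are adjacent, as [chi 1 = 1]. *)
Lemma character_connected : connected_graph e.
Proof.
have D_gt0 : (0 < D)%N by apply: ltnW.
have [e_sym _] := character_undirected.
have from0 (v : 'I_D) : connect e (Ordinal D_gt0) v.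
  case: v => v; elim: v => [|v IHv] lt_v; first by apply: eq_connect0; apply: val_inj.
  apply: connect_trans (IHv (ltnW lt_v)) (connect1 _).
  by rewrite eE /= intS addrK (char1 chi_char).
move=> u v; apply: connect_trans (from0 v).
by rewrite (sym_connect_sym e_sym).
Qed.

(** Here [y] is twice an eigenvalue and the degree is [phi / 2]; squaring removes the root, and
    doubling the halves, from both the nontriviality condition and the Ramanujan bound. *)
Lemma character_graph_ramanujan :
  ramanujan e R <->
  forall (y : R) (k : 'I_D),
    (y%:C)%C = ramanujan_sum D z k + (chi k)%:~R * tau ->
    y ^+ 2 < phi%:R ^+ 2 -> y ^+ 2 + 16%:R <= 8%:R * phi%:R.
Proof.
have [r phiE reg_r] := character_degree.
have phi_gt0 : (0 < phi)%N by rewrite totient_gt0 ltnW.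
have r_ge1 : 1 <= r%:R :> R by rewrite ler1n; case: r phiE {reg_r}; lia.
have phiR : phi%:R = 2%:R * r%:R :> R by rewrite -phiE natrM.
have lt_r (x : R) : (`|x| < r%:R) = ((2%:R * x) ^+ 2 < phi%:R ^+ 2).
  rewrite phiR !exprMn ltr_pM2l ?exprn_gt0 // -[x ^+ 2]real_normK ?num_real //.
  by rewrite ltr_pXn2r ?nnegrE.
have le_sqrt (x : R) : (`|x| <= 2%:R * Num.sqrt (r%:R - 1)) =
    ((2%:R * x) ^+ 2 + 16%:R <= 8%:R * phi%:R).
  rewrite -(@ler_pXn2r _ 2) ?nnegrE ?mulr_ge0 ?sqrtr_ge0 //.
  rewrite exprMn sqr_sqrtr ?subr_ge0 // real_normK ?num_real // phiR exprMn.
  by apply/idP/idP; lra.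
have eigP (x : R) : x \in eigenvalues e R <-> exists k : 'I_D,
    ((2%:R * x)%:C)%C = ramanujan_sum D z k + (chi k)%:~R * tau.
  rewrite (eigenvalues_circulant _ prim_z indic_per eE).
  split=> -[k xk]; exists k; last first.
    by apply: (mulfI two_neq0); rewrite dft_indicator -xk rmorphM /= rmorph_nat.
  by rewrite -dft_indicator -xk rmorphM /= rmorph_nat.
split=> [[s [_ _ reg_s le_lambda]] y k yk lt_y|le_eig].
  have D_gt0 : (0 < D)%N by apply: ltnW.
  have eq_sr : s = r by rewrite -(reg_r (Ordinal D_gt0)) reg_s.
  rewrite {}eq_sr {reg_s} in le_lambda.
  have y2 : 2%:R * (y / 2%:R) = y by rewrite mulrC divfK // pnatr_eq0.
  rewrite -y2 -le_sqrt; apply: le_trans le_lambda.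
  apply: (le_bigmax_seq _ _ _ (fun a => `|a|)); last by rewrite lt_r y2.
  by apply/eigP; exists k; rewrite y2.
exists r; split; [exact: character_undirected | exact: character_connected | by []|].
(* The default 0 of the maximum must also lie below the bound, which is nonnegative. *)
rewrite /lambda big_seq_cond; apply: bigmax_le.
  by rewrite mulr_ge0 ?sqrtr_ge0.
move=> x /andP[/eigP[k xk]]; rewrite lt_r le_sqrt.
exact: le_eig xk.
Qed.

(** At [k = N] the Gauss term vanishes, and the Ramanujan sum is [- phi / (p - 1)] because [D]
    divides [N * c]. *)
Lemma ramanujan_prime_bound (p N : nat) :
    ramanujan e R -> prime p -> odd p -> coprime p N -> (1 < N)%N ->
    D = (p * N)%N ->
  (phi ^ 2 + 16 * p.-1 ^ 2 <= 8 * phi * p.-1 ^ 2)%N.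
Proof.
move=> ram p_pr p_odd cop_pN N_gt1 eqD.
have p_gt2 : (2 < p)%N by rewrite odd_prime_gt2.
have p1_gt0 : (0 < p.-1)%N by lia.
have p1_neq0 : (p.-1)%:R != 0 :> R by rewrite pnatr_eq0; lia.
have lt_N : (N < D)%N by rewrite eqD; nia.
have phi_gt0 : (0 < phi)%N by rewrite totient_gt0 ltnW.
move/character_graph_ramanujan: ram.
move=> /(_ (- (phi%:R / (p.-1)%:R)) (Ordinal lt_N)).
have -> : chi (Ordinal lt_N) = 0.
  apply/eqP; rewrite (char_eq0 chi_char) coprimezE /= eqD coprimeMr.
  by rewrite /coprime gcdnn (gtn_eqF N_gt1) andbF.
have cN : ((p.-1)%:R * ramanujan_sum D z N = - phi%:R :> C)%R.
  have [c p_c N_c] := coprime_idempotent cop_pN.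
  rewrite (ramanujan_sum_prime prim_z p_pr cop_pN eqD _ p_c N_c).
    rewrite (ramanujan_sum_dvd prim_z) //.
    by rewrite {1}eqD mulnC PoszM dvdz_mul.
  by rewrite dvdzE /= -prime_coprime.
rewrite mul0r addr0 => bound.
have {bound} : (phi%:R / p.-1%:R) ^+ 2 + 16%:R <= 8%:R * phi%:R :> R.
  rewrite -[_ ^+ 2]sqrrN; apply: bound.
    apply: (@mulfI _ (p.-1)%:R); first by rewrite pnatr_eq0; lia.
    rewrite cN rmorphN rmorphM fmorphV /= !rmorph_nat mulrN mulrCA divff ?mulr1 //.
    by rewrite pnatr_eq0; lia.
  (* The eigenvalue is nontrivial because [p] is odd, so that [p - 1] exceeds 1. *)
  rewrite sqrrN ltr_pXn2r ?nnegrE ?divr_ge0 ?ler0n //.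
  rewrite ltr_pdivrMr ?ltr0n // -natrM ltr_nat.
  by rewrite ltn_Pmulr //; lia.
rewrite -(ler_pM2r (x := (p.-1)%:R ^+ 2)) ?exprn_gt0 ?ltr0n //.
by rewrite mulrDl -exprMn divfK // -!natrX -!natrM -!natrD ler_nat.
Qed.

End CharacterGraph.

(** * Values of Ramanujan sums and sufficiency *)

Lemma squarefree_ndvdP (M : nat) (k : int) : squarefreen M -> ~~ (M%:Z %| k)%Z ->
  exists p : nat, [/\ prime p, (p %| M)%N & ~~ (p%:Z %| k)%Z].
Proof.
move=> sqf_M; rewrite dvdzE /= => M_k.
have M_gt0 : (0 < M)%N.
  by rewrite lt0n; apply/eqP => M0; have := sqf_M 2%N; rewrite M0 dvdn0 => /(_ isT).
have [N eqM] : exists N, M = (gcdn M `|k| * N)%N.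
  by have /dvdnP[N eqM] := dvdn_gcdl M `|k|; exists N; rewrite mulnC -eqM.
have N_gt1 : (1 < N)%N.
  case: N eqM => [|[|//]]; first by rewrite muln0 => M0; rewrite M0 in M_gt0.
  by rewrite muln1 => eqM; rewrite eqM dvdn_gcdr in M_k.
(* A prime of the cofactor [N] that divided [k] would also divide the gcd, so its square would
   divide [M]. *)
have p_pr := pdiv_prime N_gt1; have p_N := pdiv_dvd N.
set p := pdiv N in p_pr p_N; have p_M : (p %| M)%N by rewrite eqM dvdn_mull.
exists p; split=> //; apply/negP; rewrite dvdzE /= => p_k.
have : p = 1%N by apply: sqf_M; rewrite eqM expnS expn1 dvdn_mul // dvdn_gcd p_M.
by move=> p1; rewrite p1 in p_pr.
Qed.

Section RamanujanSumValues.
Variables (K : fieldType) (D : nat) (z : K).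
Hypothesis prim_z : D.-primitive_root z.

(** Translation by [2 * M] preserves coprimality to both [2 ^ s] and [M]. *)
Lemma ramanujan_sum_2part (s M : nat) (k : int) :
    (1 < s)%N -> odd M -> D = (2 ^ s * M)%N -> ~~ (D%:Z %| k * (2 * M%:Z))%Z ->
  ramanujan_sum D z k = 0.
Proof.
move=> s_gt1 odd_M eqD; apply: (ramanujan_sum_shift prim_z) => a.
have s_gt0 : (0 < s)%N by apply: ltnW.
rewrite eqD PoszM !coprimezMr ![coprimez _ (2 ^ s)%N]coprimezE !coprime_pexpr //.
rewrite -![coprime _ 2]/(coprimez _ 2%N).
congr (_ && _); apply: coprimez_congr; rewrite addrAC subrr add0r.
  exact: dvdz_mulr.
exact: dvdz_mull.
Qed.

Lemma ramanujan_sum_coprime_even (s M : nat) (k : int) :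
    (1 < s)%N -> odd M -> D = (2 ^ s * M)%N -> coprimez k D ->
  ramanujan_sum D z k = 0.
Proof.
move=> s_gt1 odd_M eqD cop_k; apply: (ramanujan_sum_2part s_gt1 odd_M eqD).
apply/negP; rewrite eqD; case: s s_gt1 eqD => [|[|s]] // _ eqD.
have -> : (2 ^ s.+2 * M)%N = (2 ^ s * 2 * (2 * M))%N by rewrite !expnS; lia.
rewrite PoszM [(2 * M)%N%:Z]PoszM dvdz_mul2r; last first.
  by case: M odd_M {eqD} => // M _; lia.
move=> dvd_k; have : (2 %| k)%Z by apply: dvdz_trans dvd_k; rewrite PoszM dvdz_mull.
move: cop_k; rewrite eqD !expnS -mulnA PoszM coprimezMr => /andP[cop_k _].
by rewrite dvdzE /= dvdn2 -coprime2n coprime_sym -[coprime _ _]/(coprimez k 2) cop_k.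
Qed.

End RamanujanSumValues.

Section RamanujanSumUnit.
Variables (K : numFieldType) (D : nat) (z : K).
Hypothesis prim_z : D.-primitive_root z.

Let pred_neq0 (p : nat) : prime p -> (p.-1)%:R != 0 :> K.
Proof. by move/prime_gt1; rewrite pnatr_eq0; case: p => [|[]]. Qed.

(** At a unit the Ramanujan sum is the Möbius value of [D]; here the cofactor is 1 and the
    idempotent is 0. *)
Lemma ramanujan_sum_coprime_prime (k : int) :
  prime D -> coprimez k D -> ramanujan_sum D z k = -1.
Proof.
move=> p_pr cop_k.
have p_k : ~~ (D%:Z %| k)%Z by rewrite dvdzE -prime_coprime // coprime_sym -coprimezE.
have eqD : D = (D * 1)%N by rewrite muln1.
have := ramanujan_sum_prime prim_z p_pr (coprimen1 D) eqD p_k (dvdz0 _) (dvd1z _).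
rewrite mulr0 ramanujan_sum0 totient_prime // => eq_c.
by apply: (mulfI (pred_neq0 p_pr)); rewrite eq_c mulrN1.
Qed.

(** Peeling off [p1] and then [p2] produces two signs and ends at a multiple of [D]. *)
Lemma ramanujan_sum_coprime_prime2 (p1 p2 : nat) (k : int) :
    prime p1 -> prime p2 -> coprime p1 p2 -> D = (p1 * p2)%N -> coprimez k D ->
  ramanujan_sum D z k = 1.
Proof.
move=> p1_pr p2_pr cop12 eqD cop_k.
have [cop1 cop2] : coprimez k p1 /\ coprimez k p2.
  by apply/andP; rewrite -coprimezMr -PoszM -eqD.
have cop21 : coprime p2 p1 by rewrite coprime_sym.
have eqD' : D = (p2 * p1)%N by rewrite mulnC.
have ndvd p : prime p -> coprimez k p -> ~~ (p%:Z %| k)%Z.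
  by move=> p_pr; rewrite dvdzE -prime_coprime // coprime_sym coprimezE.
have p1_k := ndvd _ p1_pr cop1; have p2_k := ndvd _ p2_pr cop2.
have [c p1_c p2_c] := coprime_idempotent cop12.
have [d p2_d p1_d] := coprime_idempotent cop21.
have p2_kc : ~~ (p2%:Z %| k * c)%Z.
  apply: contra p2_k => p2_kc; have -> : k = k * c - k * (c - 1) by ring.
  by rewrite rpredB // dvdz_mull.
have eq1 := ramanujan_sum_prime prim_z p1_pr cop12 eqD p1_k p1_c p2_c.
have eq2 := ramanujan_sum_prime prim_z p2_pr cop21 eqD' p2_kc p2_d p1_d.
apply: (mulfI (pred_neq0 p1_pr)); apply: (mulfI (pred_neq0 p2_pr)).
rewrite eq1 mulrN eq2 opprK (ramanujan_sum_dvd prim_z); last first.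
  by rewrite eqD PoszM -mulrA dvdz_mull // dvdz_mul.
by rewrite eqD totient_coprime // !totient_prime // mulr1 natrM mulrC.
Qed.

End RamanujanSumUnit.

Section Sufficiency.
Variables (R : rcfType) (D : nat) (chi : int -> int) (z : R[i]).
Variable e : rel 'I_D.
Hypotheses (chi_char : quadratic_character D chi) (chiN1 : chi (-1) = 1).
Hypotheses (D_gt2 : (2 < D)%N) (prim_z : D.-primitive_root z).
Hypothesis eE : forall u v : 'I_D, e u v = (chi (v%:Z - u%:Z) == 1).

Variables s M : nat.
Hypotheses (s_neq1 : s != 1%N) (odd_M : odd M) (sqf_M : squarefreen M).
Hypothesis eqD : D = (2 ^ s * M)%N.

Local Notation C := R[i].
Local Notation phi := (totient D).
Local Notation tau := (gauss_sum D chi z).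

Let complex_inj : injective (real_complex R) := @fmorph_inj _ _ (real_complex R).

Let two_neq0 : 2%:R != 0 :> C. Proof. by rewrite pnatr_eq0. Qed.

(** This is the bound needed for the eigenvalue 0; [phi] is positive and twice the degree. *)
Let phi_ge2 : (2 <= phi)%N.
Proof.
have phi_gt0 : (0 < phi)%N by rewrite totient_gt0; lia.
have [r phiE _] := character_degree chi_char (ltnW D_gt2) prim_z eE.
by lia.
Qed.

(* [k] coprime to [D]: here [y - u] is a square root of [D]. *)
Let coprime_bound (k : int) (u : int) (y : R) :
    coprimez k D -> ramanujan_sum D z k = u%:~R ->
    (1 + u ^+ 2) * (1 + D%:Z) + 16 <= 8 * phi%:Z ->
    (y%:C)%C = ramanujan_sum D z k + (chi k)%:~R * tau ->
  y ^+ 2 + 16%:R <= 8%:R * phi%:R.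
Proof.
move=> cop_k -> bound yk; have tau2 := gauss_sum_sqr chi_char prim_z two_neq0.
rewrite chiN1 mul1r -pmulrn in tau2.
have sq_y : (y - u%:~R) ^+ 2 = D%:R.
  apply: complex_inj; rewrite rmorphXn rmorphB rmorph_int rmorph_nat /= yk.
  rewrite addrC addKr exprMn tau2 -rmorphXn /=.
  by case: chi_char => _ _ -> _; rewrite cop_k mul1r.
have {}bound : (1 + (u%:~R) ^+ 2) * (1 + D%:R) + 16%:R <= 8%:R * phi%:R :> R.
  have : ((1 + u ^+ 2) * (1 + D%:Z) + 16)%:~R <= (8 * phi%:Z)%:~R :> R.
    by rewrite ler_int.
  by rewrite !(rmorphD, rmorphM, rmorphXn) /= -!pmulrn.
(* Cauchy-Schwarz for [y = u * 1 + 1 * (y - u)]; the defect is the square of [1 - u * (y - u)]. *)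
rewrite -sq_y in bound; apply: le_trans bound; rewrite lerD2r -subr_ge0.
have := sqr_ge0 (1 - u%:~R * (y - u%:~R)); congr (_ <= _); ring.
Qed.

(** Up to sign, [(p - 1) * y] is another Ramanujan sum, hence at most [phi] in absolute value. The
    inequality found at [D / p] thus covers all [k] prime to [p] where the Gauss term is absent. *)
Let prime_bound (p N : nat) (k : int) (y : R) :
    prime p -> odd p -> coprime p N -> D = (p * N)%N -> ~~ (p%:Z %| k)%Z ->
    (phi ^ 2 + 16 * p.-1 ^ 2 <= 8 * phi * p.-1 ^ 2)%N ->
    (y%:C)%C = ramanujan_sum D z k ->
  y ^+ 2 + 16%:R <= 8%:R * phi%:R.
Proof.
move=> p_pr p_odd cop_pN eqDN p_k bound yk.
have p1_gt0 : (0 < p.-1)%N by case: p p_pr {p_odd cop_pN eqDN p_k bound} => [|[]].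
have le_y : ((p.-1)%:R * y) ^+ 2 <= phi%:R ^+ 2.
  have [c p_c N_c] := coprime_idempotent cop_pN.
  have := ramanujan_sum_prime prim_z p_pr cop_pN eqDN p_k p_c N_c.
  rewrite -yk => eq_y; rewrite -lecR.
  rewrite -[leLHS]ger0_norm; last by rewrite ler0c sqr_ge0.
  rewrite !rmorphXn rmorphM !rmorph_nat /= eq_y sqrrN normrX.
  rewrite lerXn2r ?nnegrE ?ler0n //.
  exact: ramanujan_sum_le.
have {}bound : phi%:R ^+ 2 + 16%:R * (p.-1)%:R ^+ 2
    <= 8%:R * phi%:R * (p.-1)%:R ^+ 2 :> R.
  by rewrite -!natrX -!natrM -natrD ler_nat.
have p1R : 0 < (p.-1)%:R ^+ 2 :> R by rewrite exprn_gt0 ?ltr0n.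
rewrite -(ler_pM2r p1R); apply: le_trans bound; rewrite mulrDl lerD2r.
by rewrite mulrC -exprMn.
Qed.

Lemma ramanujan_sufficient :
    (forall p N, prime p -> odd p -> (1 < N)%N -> D = (p * N)%N ->
       (phi ^ 2 + 16 * p.-1 ^ 2 <= 8 * phi * p.-1 ^ 2)%N) ->
    (forall k, coprimez k D -> exists2 u : int, ramanujan_sum D z k = u%:~R
       & (1 + u ^+ 2) * (1 + D%:Z) + 16 <= 8 * phi%:Z) ->
  ramanujan e R.
Proof.
move=> bound unit_bound.
apply/(character_graph_ramanujan chi_char chiN1 (ltnW D_gt2) prim_z eE) => y k yk lt_y.
move: (nat_of_ord k) yk => {}k yk.
have [cop_k|ncop_k] := boolP (coprimez k%:Z D).
  have [u ck le_u] := unit_bound _ cop_k.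
  exact: (coprime_bound cop_k ck le_u yk).
have chik : chi k = 0 by apply/eqP; rewrite (char_eq0 chi_char).
rewrite chik mul0r addr0 in yk.
have [M_k|M_k] := boolP (M%:Z %| k%:Z)%Z; last first.
  have [p [p_pr p_M p_k]] := squarefree_ndvdP sqf_M M_k.
  have p_odd : odd p by apply: dvdn_odd p_M odd_M.
  have [N eqM] : exists N, M = (p * N)%N.
    by case/dvdnP: p_M => N ->; exists N; rewrite mulnC.
  have eqDp : D = (p * (2 ^ s * N))%N by rewrite eqD eqM mulnCA.
  have cop_p : coprime p (2 ^ s * N).
    rewrite coprimeMr (@squarefreen_prime_coprime p N p_pr) -?eqM // andbT.
    by rewrite coprimeXr // coprimen2.
  (* A trivial cofactor would mean [D = p], making [k] coprime to [D]. *)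
  have N_gt1 : (1 < 2 ^ s * N)%N.
    rewrite ltnNge; apply: contra ncop_k => N_le1.
    have N1 : (2 ^ s * N = 1)%N.
      by move: D_gt2 N_le1; rewrite eqDp; case: (_ * N)%N => [|[]]; rewrite ?muln0.
    have Dp : D = p by rewrite eqDp N1 muln1.
    have kp : coprime k p by rewrite coprime_sym prime_coprime.
    by rewrite coprimezE /= [X in coprime _ X]Dp.
  exact: (prime_bound p_pr p_odd cop_p eqDp p_k (bound _ _ p_pr p_odd N_gt1 eqDp)).
(* From here [M] divides [k]: the Ramanujan sum is 0 or has absolute value [phi], and [lt_y]
   excludes the latter. *)
have no_max (c2 : ramanujan_sum D z k ^+ 2 = phi%:R ^+ 2) : False.
  move: lt_y; suff -> : y ^+ 2 = phi%:R ^+ 2 by rewrite ltxx.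
  by apply: complex_inj; rewrite !rmorphXn rmorph_nat /= yk.
have [s0|s_neq0] := eqVneq s 0%N.
  by case: no_max; rewrite ramanujan_sum_dvd // eqD s0 mul1n.
have s_gt1 : (1 < s)%N by lia.
have [D_k|D_k] := boolP (D%:Z %| k%:Z * (2 * M%:Z))%Z; last first.
  have y0 : y = 0.
    by apply: complex_inj; rewrite yk (ramanujan_sum_2part prim_z s_gt1 odd_M eqD).
  rewrite y0 expr0n /= add0r -natrM ler_nat; lia.
case: no_max; apply: (ramanujan_sum_dvd2 prim_z two_neq0).
  by rewrite eqD dvdn_mulr // dvdn_exp //; lia.
rewrite eqD PoszM Gauss_dvdz; last first.
  by rewrite coprimezE /= coprimeXl // coprime2n.
rewrite (dvdz_mull _ M_k) andbT.
move: D_k; rewrite eqD PoszM mulrA dvdz_mul2r; last first.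
  by case: (M) odd_M => // n _; lia.
by rewrite mulrC.
Qed.

End Sufficiency.

(** * The arithmetic of the bounds *)

Lemma squarefree_pdiv (M : nat) : (1 < M)%N -> squarefreen M ->
  exists p N : nat, [/\ prime p, M = (p * N)%N, coprime p N &
    forall q, prime q -> (q %| N)%N -> (p < q)%N].
Proof.
move=> M_gt1 sqf_M; have p_pr := pdiv_prime M_gt1.
have [N eqM] : exists N, M = (pdiv M * N)%N.
  by have /dvdnP[N eqM] := pdiv_dvd M; exists N; rewrite mulnC -eqM.
have cop_N : coprime (pdiv M) N.
  by apply: squarefreen_prime_coprime; rewrite -?eqM.
exists (pdiv M), N; split=> // q q_pr q_N.
have q_M : (q %| M)%N by rewrite eqM dvdn_mull.
rewrite ltn_neqAle pdiv_min_dvd ?prime_gt1 // andbT.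
apply: contraTneq cop_N => ->; rewrite prime_coprime // q_N.
by [].
Qed.

(* With [t] the totient of the 2-part of [D], that is 1, 2 or 4, the last
   inequality reads [q <= 8p - 9], [q <= 4p - 5] or [q <= 2p - 3]. *)
Definition paley_condition (t M : nat) : Prop :=
  [\/ M = 1%N, prime M | exists p q : nat, [/\ prime p, prime q, (p < q)%N,
     M = (p * q)%N & (t * q.+1 <= 8 * p.-1)%N]].

Lemma odd_prime_pred (p : nat) : prime p -> odd p ->
  exists2 x, p = (2 * x).+1 & (0 < x)%N.
Proof. by move=> /prime_gt1 p_gt1 p_odd; exists p./2; lia. Qed.

(** To be read with [h] the totient of [D] and [w = p.-1]; the term [16 * w ^ 2] makes the
    conclusion strict. *)
Lemma bound_lt (h w : nat) :
  (0 < w)%N -> (h ^ 2 + 16 * w ^ 2 <= 8 * h * w ^ 2)%N -> (h < 8 * w ^ 2)%N.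
Proof.
move=> w_gt0 le_h; rewrite ltnNge; apply/negP => h_ge.
have w2_gt0 : (0 < w ^ 2)%N by rewrite expn_gt0 w_gt0.
have := leq_mul (leqnn h) h_ge; lia.
Qed.

Lemma bound_ge (g w : nat) :
  (g ^ 2 + 16 <= 8 * g * w)%N ->
  ((w * g) ^ 2 + 16 * w ^ 2 <= 8 * (w * g) * w ^ 2)%N.
Proof. by move=> /(leq_mul (leqnn (w ^ 2))); lia. Qed.

Section Arithmetic.
Variables s M : nat.
Hypotheses (odd_M : odd M) (sqf_M : squarefreen M).
Hypothesis s_cases : (s == 0)%N || (s == 2)%N || (s == 3)%N.

Local Notation D := (2 ^ s * M)%N.
Local Notation phi := (totient D).
Local Notation t := (totient (2 ^ s)).

Let t_cases : [|| (s == 0) && (t == 1), (s == 2) && (t == 2)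
                | (s == 3) && (t == 4)]%N.
Proof. by move: s_cases => /orP[/orP[]|] /eqP->. Qed.

Let phiE : phi = (t * totient M)%N.
Proof. by rewrite totient_coprime // coprimeXl // coprime2n. Qed.

Lemma paley_condition_necessary :
    (forall p N, prime p -> odd p -> coprime p N -> (1 < N)%N ->
       D = (p * N)%N -> (phi ^ 2 + 16 * p.-1 ^ 2 <= 8 * phi * p.-1 ^ 2)%N) ->
  paley_condition t M.
Proof.
move=> bound; have [M1|M_neq1] := eqVneq M 1%N; first by constructor 1.
have M_gt1 : (1 < M)%N by case: (M) M_neq1 odd_M => [|[]].
have [p [N [p_pr eqM cop_p p_min]]] := squarefree_pdiv M_gt1 sqf_M.
have [N1|N_neq1] := eqVneq N 1%N.
  by constructor 2; rewrite eqM N1 muln1.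
have [p_odd odd_N] : odd p /\ odd N by apply/andP; rewrite -oddM -eqM.
have N_gt1 : (1 < N)%N by case: (N) N_neq1 odd_N => [|[]].
have sqf_N : squarefreen N by move: sqf_M; rewrite eqM => /squarefreenMr.
have [q [L [q_pr eqN cop_q q_min]]] := squarefree_pdiv N_gt1 sqf_N.
have [q_odd odd_L] : odd q /\ odd L by apply/andP; rewrite -oddM -eqN.
have lt_pq : (p < q)%N by apply: p_min => //; rewrite eqN dvdn_mulr.
have eqD : D = (p * (2 ^ s * N))%N by rewrite eqM mulnCA.
have cop_pN : coprime p (2 ^ s * N).
  by rewrite coprimeMr cop_p andbT coprimeXr // coprimen2.
have {bound} := bound p (2 ^ s * N)%N p_pr p_odd cop_pN _ eqD.
have -> : (1 < 2 ^ s * N)%N by rewrite (leq_trans N_gt1) // leq_pmull // expn_gt0.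
move=> /(_ isT); rewrite phiE eqM totient_coprime // (totient_prime p_pr).
rewrite eqN totient_coprime // (totient_prime q_pr).
have := t_cases; move: (totient (2 ^ s)) => u u_cases.
have [x eqp x_gt0] := odd_prime_pred p_pr p_odd.
have [y eqq y_gt0] := odd_prime_pred q_pr q_odd.
have [L1|L_neq1] := eqVneq L 1%N; last first.
  have L_gt1 : (1 < L)%N by case: (L) L_neq1 odd_L => [|[]].
  have sqf_L : squarefreen L by move: sqf_N; rewrite eqN => /squarefreenMr.
  have [r [F [r_pr eqL cop_r _]]] := squarefree_pdiv L_gt1 sqf_L.
  have [r_odd odd_F] : odd r /\ odd F by apply/andP; rewrite -oddM -eqL.
  have lt_qr : (q < r)%N by apply: q_min => //; rewrite eqL dvdn_mulr.
  have [w eqr w_gt0] := odd_prime_pred r_pr r_odd.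
  have F_gt0 : (0 < totient F)%N by rewrite totient_gt0 odd_gt0.
  rewrite eqL totient_coprime // (totient_prime r_pr).
  move: (totient F) F_gt0 => f f_gt0.
  rewrite eqp eqq eqr /=.
  set h := (u * _)%N => le_h.
  (* With [x < y < w], the product [y * w] is at least [(x + 1) * (x + 2)], hence at least [4 * x]:
     a third prime makes the totient too large. *)
  have h_ge : (8 * (2 * x) ^ 2 <= h)%N.
    have -> : (8 * (2 * x) ^ 2 = 1 * (2 * x * (16 * x * 1)))%N by lia.
    rewrite /h leq_mul //; first by move: u_cases; lia.
    rewrite leq_mul //.
    have -> : (2 * y * (2 * w * f) = 4 * (y * w) * f)%N by lia.
    rewrite leq_mul //.
    have [x_lt w_ge] : (x.+1 <= y)%N /\ (x.+2 <= w)%N.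
      by clear -lt_pq lt_qr eqp eqq eqr; lia.
    by have := leq_mul x_lt w_ge; clear -x_gt0; nia.
  have x2_gt0 : (0 < 2 * x)%N by rewrite muln_gt0.
  by have := bound_lt x2_gt0 le_h; rewrite ltnNge h_ge.
move=> le_h; constructor 3; exists p, q; split => //; first by rewrite L1 muln1.
have x2_gt0 : (0 < 2 * x)%N by rewrite muln_gt0.
move: le_h; rewrite L1 -[totient 1]/1%N eqp eqq /= => /(bound_lt x2_gt0) lt_h.
have {lt_h} : (4 * x * (u * y) < 4 * x * (8 * x))%N.
  by clear -lt_h; lia.
rewrite ltn_pmul2l; last by rewrite muln_gt0.
(* As [u] divides 8, the strict [u * y < 8 * x] improves to [u * (y + 1) <= 8 * x]. *)
by clear -u_cases; case/or3P: u_cases => /andP[_ /eqP->]; lia.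
Qed.

Lemma paley_condition_bound : (2 < D)%N -> paley_condition t M ->
  forall p N, prime p -> odd p -> (1 < N)%N -> D = (p * N)%N ->
    (phi ^ 2 + 16 * p.-1 ^ 2 <= 8 * phi * p.-1 ^ 2)%N.
Proof.
move=> D_gt2 cond p N p_pr p_odd N_gt1 eqD.
have p_M : (p %| M)%N.
  have : (p %| D)%N by rewrite eqD dvdn_mulr.
  by rewrite Gauss_dvdr // coprimeXr // coprimen2.
have [x eqp x_gt0] := odd_prime_pred p_pr p_odd.
case: cond => [M1|M_pr|[p1 [p2 [p1_pr p2_pr lt_p eqM le_p]]]].
- by move: p_M; rewrite M1 dvdn1 => /eqP p1; rewrite p1 in p_pr.
- move: p_M; rewrite dvdn_prime2 // => /eqP pM.
  (* If [t] were 1, then [D] would equal [p] and leave no cofactor [N > 1]. *)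
  have t_gt1 : (1 < t)%N.
    case/or3P: t_cases => /andP[/eqP s0 /eqP->] //.
    move: eqD N_gt1; rewrite s0 -pM mul1n -[X in X = _]muln1 => /eqP.
    by rewrite eqn_pmul2l ?prime_gt0 // => /eqP <-.
  rewrite phiE -pM (totient_prime p_pr) eqp.
  move: (totient (2 ^ s)) t_cases t_gt1 => u u_cases u_gt1 /=.
  rewrite mulnC; apply: bound_ge.
  by clear -u_cases u_gt1 x_gt0; case/or3P: u_cases u_gt1 => /andP[_ /eqP->] // _; lia.
- have [odd1 odd2] : odd p1 /\ odd p2 by apply/andP; rewrite -oddM -eqM.
  have [x1 eqp1 x1_gt0] := odd_prime_pred p1_pr odd1.
  have [x2 eqp2 x2_gt0] := odd_prime_pred p2_pr odd2.
  have cop12 : coprime p1 p2.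
    by rewrite prime_coprime // dvdn_prime2 // neq_ltn lt_p.
  rewrite phiE eqM totient_coprime // (totient_prime p1_pr) (totient_prime p2_pr).
  move: p_M; rewrite eqM Euclid_dvdM // !dvdn_prime2 //.
  have := t_cases; move: (totient (2 ^ s)) le_p => u le_p u_cases.
  have {}le_p : (u * (x2 + 1) <= 8 * x1)%N.
    by move: le_p; rewrite eqp1 eqp2 /=; clear; lia.
  have {}lt_p : (x1 < x2)%N by clear -lt_p eqp1 eqp2; lia.
  case/orP => /eqP->; rewrite eqp1 eqp2 /=.
    have -> : (u * (2 * x1 * (2 * x2)) = 2 * x1 * (u * (2 * x2)))%N.
      by clear; lia.
    apply: bound_ge.
    (* The product leaves a margin of [4 * u ^ 2 * x2], which absorbs 16 once [x2 >= 4]; smaller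
       [x2] are treated apart. *)
    have := leq_mul (leqnn (4 * u * x2)) le_p.
    have [x2_ge4|] := leqP 4 x2; last first.
      by clear -u_cases lt_p x1_gt0; case/or3P: u_cases => /andP[_ /eqP->]; nia.
    by clear -u_cases x2_ge4; case/or3P: u_cases => /andP[_ /eqP->]; nia.
  have -> : (u * (2 * x1 * (2 * x2)) = 2 * x2 * (u * (2 * x1)))%N.
    by clear; lia.
  apply: bound_ge.
  have u_le : (u * (2 * x1) <= 8 * x2)%N.
    move: le_p; clear -u_cases lt_p x1_gt0.
    by case/or3P: u_cases => /andP[_ /eqP->]; lia.
  have := leq_mul (leqnn (u * (2 * x1))) u_le.
  have : (1 * 2 <= u * (2 * x1))%N by rewrite leq_mul //; clear -u_cases x1_gt0; lia.
  by clear -lt_p x1_gt0; nia.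
Qed.

End Arithmetic.

(** The witness [u] is the Möbius value of [D]: -1 for a prime, 1 for two primes, 0 for even [D].
    The side conditions on [M] exclude [D = 3] and [D = 4], where the inequality fails. *)
Lemma paley_condition_unit_bound (K : numFieldType) (s M : nat) (z : K) :
    let D := (2 ^ s * M)%N in
    odd M -> (s == 0)%N || (s == 2)%N || (s == 3)%N ->
    (s = 0%N -> (4 < M)%N) -> (M = 1%N -> s = 3%N) ->
    D.-primitive_root z -> paley_condition (totient (2 ^ s)) M ->
  forall k, coprimez k D -> exists2 u : int, ramanujan_sum D z k = u%:~R
    & (1 + u ^+ 2) * (1 + D%:Z) + 16 <= 8 * (totient D)%:Z.
Proof.
move=> D odd_M s_cases M_gt4 M1_s prim_z cond k cop_k.
have phiE : totient D = (totient (2 ^ s) * totient M)%N.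
  by rewrite totient_coprime // coprimeXl // coprime2n.
have pair p q : prime p -> prime q -> (p < q)%N -> M = (p * q)%N ->
    exists x y : nat, [/\ p = (2 * x).+1, q = (2 * y).+1, (0 < x < y)%N
      & totient M = (2 * x * (2 * y))%N].
  move=> p_pr q_pr lt_pq eqM.
  have [p_odd q_odd] : odd p /\ odd q by apply/andP; rewrite -oddM -eqM.
  have [x eqp x_gt0] := odd_prime_pred p_pr p_odd.
  have [y eqq y_gt0] := odd_prime_pred q_pr q_odd.
  have cop_pq : coprime p q.
    by rewrite prime_coprime // dvdn_prime2 // neq_ltn lt_pq.
  exists x, y; split=> //; first by clear -x_gt0 eqp eqq lt_pq; lia.
  by rewrite eqM totient_coprime // (totient_prime p_pr) (totient_prime q_pr) eqp eqq.
have [s0|s_neq0] := eqVneq s 0%N.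
  have eqD : D = M by rewrite /D s0 mul1n.
  have {}M_gt4 := M_gt4 s0.
  have {}phiE : totient D = totient M by rewrite eqD.
  case: cond => [M1|M_pr|[p [q [p_pr q_pr lt_pq eqM _]]]].
  - by rewrite M1 in M_gt4.
  - exists (-1); first by rewrite (ramanujan_sum_coprime_prime prim_z) // eqD.
    by rewrite phiE (totient_prime M_pr) eqD; clear -M_gt4; lia.
  - have [x [y [eqp eqq xy totM]]] := pair _ _ p_pr q_pr lt_pq eqM.
    exists 1.
      apply: (ramanujan_sum_coprime_prime2 prim_z p_pr q_pr) cop_k.
        by rewrite prime_coprime // dvdn_prime2 // neq_ltn lt_pq.
      by rewrite eqD.
    rewrite phiE totM eqD eqM eqp eqq.
    have [y_gt1 x_gt0] : (1 < y)%N /\ (0 < x)%N by clear -xy; lia.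
    have := leq_mul (leqnn x) y_gt1; have := leq_mul x_gt0 (leqnn y).
    by clear -y_gt1 x_gt0; nia.
have s_gt1 : (1 < s)%N by clear -s_cases s_neq0; lia.
exists 0; first exact: (ramanujan_sum_coprime_even prim_z s_gt1 odd_M) cop_k.
rewrite expr0n /= addr0 mul1r phiE {phiE}.
have {s_cases s_gt1 s_neq0}s_cases : [|| (2 ^ s == 4) && (totient (2 ^ s) == 2)
    && (s != 3) | (2 ^ s == 8) && (totient (2 ^ s) == 4)]%N.
  by move: s_cases s_neq0 => /orP[/orP[]|] /eqP->.
rewrite /D; move: (totient (2 ^ s)) s_cases cond => u.
move: (2 ^ s)%N => e s_cases cond.
case: cond => [M1|M_pr|[p [q [p_pr q_pr lt_pq eqM _]]]].
- have s3 := M1_s M1; rewrite M1 -[totient 1]/1%N; move: s_cases; rewrite s3 andbF /=.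
  by case/andP => /eqP-> /eqP->.
- have [x eqM x_gt0] := odd_prime_pred M_pr odd_M.
  rewrite (totient_prime M_pr) eqM; clear -s_cases x_gt0.
  by case/orP: s_cases => [/andP[]|] /andP[/eqP-> /eqP->]; lia.
- have [x [y [eqp eqq xy totM]]] := pair _ _ p_pr q_pr lt_pq eqM.
  rewrite totM eqM eqp eqq.
  have [y_gt1 x_gt0] : (1 < y)%N /\ (0 < x)%N by clear -xy; lia.
  have := leq_mul (leqnn x) y_gt1; have := leq_mul x_gt0 (leqnn y).
  clear -s_cases y_gt1 x_gt0.
  by case/orP: s_cases => [/andP[]|] /andP[/eqP-> /eqP->]; nia.
Qed.

(** * The graph [paley] in terms of the 2-part and the odd part of [D] *)

Lemma paley_ramanujanP (R : rcfType) (s M : nat) :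
    let D := (2 ^ s * M)%N in
    odd M -> squarefreen M -> discriminant_spec D M ->
    (s == 0)%N || (s == 2)%N || (s == 3)%N ->
  ramanujan (@paley D%:Z) R <-> paley_condition (totient (2 ^ s)) M.
Proof.
move=> D odd_M sqf_M D_spec s_cases.
have M_gt0 : (0 < M)%N by rewrite odd_gt0.
have D_cases : [/\ (2 < D)%N, s = 0%N -> (4 < M)%N & M = 1%N -> s = 3%N].
  move: D_spec; rewrite /D; clear -odd_M M_gt0 s_cases.
  case/orP: s_cases => [/orP[]|] /eqP->.
  - by rewrite mul1n => -[] *; split; lia.
  - by rewrite -[(2 ^ 2)%N]/4%N => -[] *; split; lia.
  - by rewrite -[(2 ^ 3)%N]/8%N => -[] *; split; lia.
have [D_gt2 M_gt4 M1_s] := D_cases.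
have [chi chi_char [chiN1 chi2]] := discriminant_character odd_M sqf_M D_spec.
have D_neq0 : D%:R != 0 :> R[i] by rewrite pnatr_eq0; clear -D_gt2; lia.
have [z prim_z] := exists_prim_root D_neq0.
have eE (u v : 'I_D) : @paley D%:Z u v = (chi (v%:Z - u%:Z) == 1).
  by rewrite /paley (kroneckerE chi_char chiN1 chi2 (ltnW D_gt2)).
split=> [ram|cond].
  apply: paley_condition_necessary => // p N p_pr p_odd cop_pN N_gt1 eqD.
  exact: (ramanujan_prime_bound chi_char chiN1 (ltnW D_gt2) prim_z eE
    ram p_pr p_odd cop_pN N_gt1 eqD).
apply: (ramanujan_sufficient chi_char chiN1 D_gt2 prim_z eE (s := s) (M := M)) => //.
- by clear -s_cases; lia.
- by apply: paley_condition_bound.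
- exact: paley_condition_unit_bound.
Qed.

Unset Implicit Arguments.

Theorem theorem4p3 (R : rcfType) (m Delta : int) (D : nat)
  (sqf_m : squarefree m) (m_neq1 : m <> 1)
  (Delta_def : Delta = quad_disc m) (Delta_gt0 : 0 < Delta)
  (D_def : D = `|Delta|%N) :
  ramanujan (@paley Delta) R <->
  (D = 8%N
   \/ (exists p : nat, [/\ prime p, p = 3 %[mod 4] & D = (4 * p)%N])
   \/ (exists p : nat, [/\ prime p, odd p & D = (8 * p)%N])
   \/ (exists p1 p2 : nat, [/\ prime p1, prime p2, p1 * p2 = 3 %[mod 4],
         (p1 < p2 <= 4 * p1 - 5)%N & D = (4 * p1 * p2)%N])
   \/ (exists p1 p2 : nat, [/\ prime p1, prime p2,
         (2 < p1 < p2)%N, (p2 <= 2 * p1 - 3)%N & D = (8 * p1 * p2)%N])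
   \/ (prime D /\ D = 1 %[mod 4])
   \/ (exists p1 p2 : nat, [/\ prime p1, prime p2, p1 * p2 = 1 %[mod 4],
         (p1 < p2 <= 8 * p1 - 9)%N & D = (p1 * p2)%N])).
Proof.
rewrite Delta_def in Delta_gt0 D_def *.
have [M [odd_M sqf_M D_spec]] := quad_discP sqf_m m_neq1 Delta_gt0.
rewrite -D_def in D_spec; have {D_def} -> : quad_disc m = D%:Z.
  by rewrite D_def gtz0_abs.
move=> {m sqf_m m_neq1 Delta Delta_def Delta_gt0}.
have main s : (s == 0)%N || (s == 2)%N || (s == 3)%N -> D = (2 ^ s * M)%N ->
    ramanujan (@paley D%:Z) R <-> paley_condition (totient (2 ^ s)) M.
  by move=> s_cases eqD; move: D_spec; rewrite eqD => /paley_ramanujanP; apply.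
have odd_factors p q : M = (p * q)%N -> odd p /\ odd q.
  by move=> eqM; apply/andP; rewrite -oddM -eqM.
case: D_spec => [eqD M1 M_gt1|eqD M3|eqD].
- rewrite (main 0%N) ?mul1n // /paley_condition -[totient _]/1%N.
  split.
  + case=> [M_eq1|M_pr|[p [q [p_pr q_pr lt_pq eqM le_q]]]].
    * by rewrite M_eq1 in M_gt1.
    * by do 5 right; left; rewrite eqD.
    * do 6 right; exists p, q; rewrite eqD; split=> //; first by rewrite -eqM.
      (* Since [p > 1], the truncated subtraction in [8 * p - 9] is exact. *)
      by have := prime_gt1 p_pr; clear -lt_pq le_q; lia.
  + clear -odd_M eqD M1.
    case=> [|[[p []]|[[p []]|[[p [q []]]|[[p [q []]]|[[]|[p [q []]]]]]]]].
    (* These alternatives make [D] even. In the other two cases, too, the power of 2 in [D] rules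
       out the foreign alternatives. *)
    1-5: by move=> *; lia.
    * by constructor 2; rewrite -eqD.
    * move=> p_pr q_pr _ /andP[lt_pq le_q] eqM.
      constructor 3; exists p, q; split=> //; first by rewrite -eqD.
      by have := prime_gt1 p_pr; clear -le_q; lia.
- rewrite (main 2%N) // /paley_condition -[totient _]/2%N.
  split.
  + case=> [M_eq1|M_pr|[p [q [p_pr q_pr lt_pq eqM le_q]]]].
    * by rewrite M_eq1 in M3.
    * by right; left; exists M.
    * do 3 right; left; exists p, q; split=> //; first by rewrite -eqM.
        by have := prime_gt1 p_pr; clear -lt_pq le_q; lia.
      by rewrite eqD eqM mulnA.
  + clear -odd_M eqD M3.
    case=> [|[[p [p_pr _ eqp]]|[[p []]|[[p [q []]]|[[p [q []]]|[[]|[p [q []]]]]]]]].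
    * by move=> *; lia.
    * by constructor 2; have -> : M = p by clear -eqp eqD; lia.
    * by move=> *; lia.
    * move=> p_pr q_pr _ /andP[lt_pq le_q] eqM.
      constructor 3; exists p, q; split=> //; first by clear -eqM eqD; lia.
      by have := prime_gt1 p_pr; clear -le_q; lia.
    * by move=> *; lia.
    * by move=> *; lia.
    * by move=> *; lia.
- rewrite (main 3%N) // /paley_condition -[totient _]/4%N.
  split.
  + case=> [M_eq1|M_pr|[p [q [p_pr q_pr lt_pq eqM le_q]]]].
    * by left; rewrite eqD M_eq1.
    * by do 2 right; left; exists M.
    * have [p_odd q_odd] := odd_factors p q eqM.
      do 4 right; left; exists p, q; split=> //.
      - by rewrite (odd_prime_gt2 p_odd p_pr).
      - by have := prime_gt1 p_pr; clear -le_q; lia.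
      - by rewrite eqD eqM mulnA.
  + clear -odd_M eqD.
    case=> [|[[p []]|[[p [p_pr _ eqp]]|[[p [q []]]|[[p [q []]]|[[]|[p [q []]]]]]]]].
    * by move=> D8; constructor 1; clear -eqD D8; lia.
    * by move=> *; lia.
    * by constructor 2; have -> : M = p by clear -eqp eqD; lia.
    * by move=> *; lia.
    * move=> p_pr q_pr /andP[p_gt2 lt_pq] le_q eqM.
      constructor 3; exists p, q; split=> //; first by clear -eqM eqD; lia.
      by clear -le_q p_gt2; lia.
    * by move=> *; lia.
    * by move=> *; lia.
Qed.
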